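(* Let $0<\alpha,\beta<1/2$ be constants. Consider a $\sqrt{n}\times\sqrt{n}$ torus grid of $n$ servers and a library of $K=n$ files with the Uniform popularity distribution $p_j=1/K$. Each server independently caches $M=n^{\alpha}$ files, drawn independently and uniformly from the library with replacement. Then $n$ requests arrive sequentially; each request's origin server is chosen uniformly at random and its requested file uniformly at random from the library. Let $r=n^{\beta}$. If $$\alpha+2\beta\ge 1+2\,\frac{\log\log n}{\log n},$$ then under the Proximity-Aware Two Choices Strategy (Strategy II) with radius $r$, with high probability the maximum load is $L=\Theta(\log\log n)$ and the communication cost is $C=\Theta(r)$.
   Context: For a node $u$, $B_r(u)$ is the set of nodes at shortest-path distance at most $r$ from $u$ in the torus. Strategy II (Proximity-Aware Two Choices Strategy) with radius $r$: for each request born at node $u$, two nodes are chosen uniformly at random from the nodes in $B_r(u)$ that have cached the requested file, and the request is assigned to the one with lesser current load (number of requests assigned so far); ties broken randomly. With $T_i$ the number of requests assigned to server $i$ after all requests, the maximum load is $L=\max_i T_i$. The communication cost $C$ is the average number of hops between requesting and serving node. ''With high probability'' means with probability $1-1/n^c$ for some constant $c>0$. *)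

(* Defs.v *)
From mathcomp Require Import all_boot all_order all_algebra.
From mathcomp Require Import reals exp.

Set Implicit Arguments.
Unset Strict Implicit.
Unset Printing Implicit Defensive.
Import Order.TTheory GRing.Theory Num.Theory.
Local Open Scope ring_scope.

Definition node (m : nat) : finType := ('I_m * 'I_m)%type.

Definition cycle_adj (m : nat) : rel 'I_m :=
  fun a b => (b == ordS a) || (a == ordS b).

Definition torus_adj (m : nat) : rel (node m) :=
  fun u v => ((u.1 == v.1) && cycle_adj u.2 v.2)
          || ((u.2 == v.2) && cycle_adj u.1 v.1).

Definition has_walk (T : finType) (e : rel T) (u v : T) (k : nat) : bool :=
  [exists p : k.-tuple T, path e u p && (last u p == v)].

(* Least length of a walk from u to v; #|T| if v is not reachable from u. *)
Definition graph_dist (T : finType) (e : rel T) (u v : T) : nat :=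
  find (has_walk e u v) (iota 0 #|T|).

Definition tdist (m : nat) (u v : node m) : nat :=
  graph_dist (@torus_adj m) u v.

Definition tball (R : realType) (m : nat) (r : R) (u : node m) :
    {set node m} :=
  [set v | (tdist u v)%:R <= r].

Definition file (m : nat) : finType := 'I_(m ^ 2).

(* The M slots of each server; a file may occupy several slots. *)
Definition placement (m M : nat) : finType :=
  {ffun node m -> M.-tuple (file m)}.

Definition candidates (R : realType) (m M : nat) (r : R)
    (pl : placement m M) (u : node m) (j : file m) : {set node m} :=
  [set v in tball r u | j \in pl v].

(* Origin, requested file, the two sampled servers, and the fair coin that is
   used only if these two servers have equal load. *)
Definition request (m : nat) : finType :=
  (node m * file m * (node m * node m) * bool)%type.

Definition origin (m : nat) (q : request m) : node m := q.1.1.1.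
Definition wanted (m : nat) (q : request m) : file m := q.1.1.2.
Definition choices (m : nat) (q : request m) : node m * node m := q.1.2.
Definition coin (m : nat) (q : request m) : bool := q.2.

(* A history is the list of servers to which the past requests were assigned. *)
Definition load (m : nat) (h : seq (node m)) (v : node m) : nat :=
  count_mem v h.

Definition serve (m : nat) (h : seq (node m)) (q : request m) : node m :=
  let: (a, b) := choices q in
  if (load h a < load h b)%N then a
  else if (load h b < load h a)%N then b
  else if coin q then a else b.

Definition servers (m : nat) (qs : seq (request m)) : seq (node m) :=
  foldl (fun h q => rcons h (serve h q)) [::] qs.

Definition max_load (m : nat) (qs : seq (request m)) : nat :=
  \max_(v : node m) load (servers qs) v.

Definition comm_cost (R : realType) (m : nat) (qs : seq (request m)) : R :=
  (\sum_(x <- zip qs (servers qs)) tdist (origin x.1) x.2)%N%:R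
  / (size qs)%:R.

(* mu pl u j is the law of the (ordered) pair of servers sampled for a request
   for j born at u, given the cache contents pl: uniform over pairs of distinct
   candidates. The strategy does not prescribe anything when there are fewer
   than two candidates, so mu pl u j is then any probability distribution. *)
Definition two_choices_law (R : realType) (m M : nat) (r : R)
    (mu : placement m M -> node m -> file m -> node m * node m -> R) : Prop :=
  forall (pl : placement m M) (u : node m) (j : file m),
    let A := candidates r pl u j in
    [/\ forall ab, 0 <= mu pl u j ab,
        \sum_(ab : node m * node m) mu pl u j ab = 1 &
        (2 <= #|A|)%N -> forall a b : node m,
          mu pl u j (a, b) =
            if [&& a \in A, b \in A & a != b]
            then (#|A| * (#|A| - 1))%N%:R^-1 else 0].

Definition popularity (R : realType) (m : nat) (j : file m) : R :=
  (m ^ 2)%N%:R^-1.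

Definition outcome (m M : nat) : finType :=
  (placement m M * (m ^ 2).-tuple (request m))%type.

Definition placement_weight (R : realType) (m M : nat)
    (pl : placement m M) : R :=
  \prod_(v : node m) \prod_(j <- pl v) popularity R j.

Definition request_weight (R : realType) (m M : nat)
    (mu : placement m M -> node m -> file m -> node m * node m -> R)
    (pl : placement m M) (q : request m) : R :=
  (m ^ 2)%N%:R^-1 * popularity R (wanted q)
  * mu pl (origin q) (wanted q) (choices q) * 2^-1.

Definition Prob (R : realType) (m M : nat)
    (mu : placement m M -> node m -> file m -> node m * node m -> R)
    (E : pred (outcome m M)) : R :=
  \sum_(w : outcome m M | E w)
    placement_weight R w.1 * \prod_(q <- w.2) request_weight mu w.1 q.

Definition cache_size (R : realType) (m : nat) (alpha : R) : nat :=
  Num.truncn ((m ^ 2)%N%:R `^ alpha).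

Definition radius (R : realType) (m : nat) (beta : R) : R :=
  (m ^ 2)%N%:R `^ beta.

(* Main.v *)
(** Write [n = m ^ 2], [d = alpha + 2 * beta - 1] and [lam = M r^2 / n]; the
    hypothesis forces [d > 0], so [lam] is at least of order [n^d].

    Chernoff bounds over the caches show that, with high probability, every set
    of candidates has size of order [lam] and every server caches of order [M]
    distinct files.  For such a placement let [nu a b] be the probability that a
    request samples the pair [(a, b)].  Then [nu a b = O(1 / (n lam))], the row
    sums of [nu] are [O(1 / n)], and, by Cauchy-Schwarz over the origin and the
    file, [nu (S x S) >= c (|S| / n)^2] once [|S| / n] exceeds a constant times
    [1 / lam].

    Upper bound on the load: layered induction localised at a server. Let
    [p_i v] be the probability of sampling [v] together with a server of load
    at least [i].  If [p_i <= b / n] everywhere, then a constant number of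
    levels higher [p <= b^2 / n] up to constants, because both sampled servers
    must be heavy; after [O(log log n)] levels [p <= n^(-1-d/2)], and then no
    server receives more than a constant number of further requests.

    Lower bound on the load: while the servers of load at least [i] have density
    [x_i], a request finds two servers of load exactly [i] with probability
    of order [x_i^2], hence the densities [x_{i+1} = y x_i^2] with
    [y = c / (32 l)] are all reached for [i <= l], [l] of order [log log n].

    Communication cost: candidates lie within distance [r], and a sampled
    server is within [r / 96] of the origin with probability at most [1 / 32].

    All tail bounds over the requests come from exponential supermartingales in
    the request history. *)

Require Import Defs.
From mathcomp Require Import all_boot all_order all_algebra.
From mathcomp Require Import reals sequences exp.
From mathcomp Require Import ring lra zify.

Set Implicit Arguments.
Unset Strict Implicit.
Unset Printing Implicit Defensive.
Import Order.TTheory GRing.Theory Num.Theory.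
Local Open Scope ring_scope.

(** * Supermartingales on finite sequences *)

Lemma big_tuple_cons (V : nmodType) (T : finType) (N : nat)
    (F : N.+1.-tuple T -> V) :
  \sum_(t : N.+1.-tuple T) F t =
  \sum_(q : T) \sum_(t : N.-tuple T) F (cons_tuple q t).
Proof.
rewrite pair_big /=.
rewrite (reindex (fun p : T * N.-tuple T => cons_tuple p.1 p.2)) //=.
exists (fun t : N.+1.-tuple T => (thead t, behead_tuple t)) => [[q t] _|t _] /=.
  by rewrite theadE; congr pair; apply/val_inj.
by apply/val_inj; rewrite [in RHS](tuple_eta t).
Qed.

Lemma sum_tuple_prod (R : comPzSemiRingType) (T : finType) (N : nat)
    (f : T -> R) :
  \sum_(t : N.-tuple T) \prod_(q <- t) f q = (\sum_q f q) ^+ N.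
Proof.
elim: N => [|N IH].
  rewrite (eq_bigr (fun=> 1)); last by move=> t _; rewrite tuple0 big_nil.
  by rewrite sumr_const card_tuple expn0 expr0.
rewrite big_tuple_cons exprS big_distrl /=; apply: eq_bigr => q _.
by rewrite -IH big_distrr /=; apply: eq_bigr => t _; rewrite big_cons.
Qed.

Section Supermartingale.
Variables (R : realType) (Q : finType) (w : Q -> R).
Hypothesis w0 : forall q, 0 <= w q.
Variable Psi : seq Q -> R.
Hypothesis Psi0 : forall h, 0 <= Psi h.
Hypothesis drift : forall h, \sum_q w q * Psi (rcons h q) <= Psi h.

(** Peeling off the first entry of the tuple and appending it to the history reduces the bound to
    one use of [drift]. *)
Lemma supermartingale_le (N : nat) (h : seq Q) :
  \sum_(t : N.-tuple Q) (\prod_(q <- t) w q) * Psi (h ++ t) <= Psi h.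
Proof.
elim: N h => [|N IH] h.
  rewrite (eq_bigr (fun=> Psi h)); last first.
    by move=> t _; rewrite tuple0 big_nil mul1r cats0.
  by rewrite sumr_const card_tuple expn0.
rewrite big_tuple_cons; apply: le_trans (drift h); apply: ler_sum => q _.
rewrite (eq_bigr (fun t : N.-tuple Q =>
  w q * ((\prod_(q0 <- t) w q0) * Psi (rcons h q ++ t)))); last first.
  by move=> t _; rewrite big_cons cat_rcons mulrA.
by rewrite -big_distrr /=; apply: ler_wpM2l.
Qed.

(** Markov's inequality at time [N]; every tail bound over the requests is an instance. *)
Lemma supermartingale_markov (N : nat) (E : pred (N.-tuple Q)) (K : R) :
  0 < K -> (forall t : N.-tuple Q, E t -> K <= Psi t) ->
  \sum_(t : N.-tuple Q | E t) \prod_(q <- t) w q <= Psi [::] / K.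
Proof.
move=> K0 EK; rewrite ler_pdivlMr // mulrC.
apply: le_trans (supermartingale_le N [::]).
rewrite big_distrr /= [leRHS](bigID E) /= -[leLHS]addr0.
have w0' t : 0 <= \prod_(q <- t) w q by apply: prodr_ge0.
apply: lerD; last by apply: sumr_ge0 => t _; apply: mulr_ge0.
apply: ler_sum => t Et; rewrite mulrC; apply: ler_wpM2l => //.
exact: EK.
Qed.

End Supermartingale.

Lemma sum_prob_tuple (R : realType) (Q : finType) (w : Q -> R) (N : nat) :
  \sum_q w q = 1 -> \sum_(t : N.-tuple Q) \prod_(q <- t) w q = 1.
Proof. by move=> w1; rewrite sum_tuple_prod w1 expr1n. Qed.

Lemma sum_union_le (R : numDomainType) (T I : finType) (p : T -> R)
    (E : pred T) (F : I -> pred T) :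
  (forall t, 0 <= p t) -> (forall t, E t -> exists i, F i t) ->
  \sum_(t | E t) p t <= \sum_i \sum_(t | F i t) p t.
Proof.
move=> p0 EF; under [leRHS]eq_bigr do rewrite big_mkcond.
rewrite exchange_big /= big_mkcond /=; apply: ler_sum => t _.
have nn i : 0 <= (if F i t then p t else 0) by case: ifP.
case: ifP => [/EF [i Fit]|_]; last exact: sumr_ge0.
by rewrite (bigD1 i) //= Fit lerDl sumr_ge0.
Qed.

(** Inverting [1 - x <= expR (- x)] gives [expR x <= (1 - x)^-1], which is at most [1 + 2 * x] on
    this range. *)
Lemma expR_le_half (R : realType) (x : R) :
  0 <= x <= 2^-1 -> expR x <= 1 + 2 * x.
Proof.
move=> /andP [x0 x2]; have := expR_ge1Dx (- x); rewrite expRN => H.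
have x1 : 0 < 1 - x by lra.
have : expR x <= (1 - x)^-1.
  by rewrite -[expR x]invrK lef_pV2 // posrE ?invr_gt0 ?expR_gt0.
move=> /le_trans; apply; rewrite -div1r ler_pdivrMr //; nra.
Qed.

Lemma expR_half_le2 (R : realType) : expR (2^-1 : R) <= 2.
Proof.
have := @expR_le_half R (2^-1); rewrite mulfV ?pnatr_eq0 //; apply.
by rewrite lexx andbT invr_ge0.
Qed.

(** * Two-choice allocation *)

Lemma card_node (m : nat) : #|node m| = (m ^ 2)%N.
Proof. by rewrite card_prod card_ord mulnn. Qed.

Section Allocation.
Variables (R : realType) (m : nat) (w : request m -> R).
Hypothesis w0 : forall q, 0 <= w q.
Implicit Types (h : seq (request m)) (q : request m) (a b v : node m).
Hypothesis w1 : \sum_q w q = 1.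

(** The [nu] of the opening comment. *)
Definition pair_prob (a b : node m) : R := \sum_(q | choices q == (a, b)) w q.

Definition hist_load (h : seq (request m)) (v : node m) : nat :=
  load (servers h) v.

Local Notation nu := pair_prob.
Local Notation ld := hist_load.
Local Notation srv h q := (serve (servers h) q).

Lemma pair_prob_ge0 a b : 0 <= nu a b.
Proof. exact: sumr_ge0. Qed.

Lemma sum_choices (phi : node m -> node m -> R) :
  \sum_q w q * phi (choices q).1 (choices q).2 =
  \sum_a \sum_b nu a b * phi a b.
Proof.
rewrite pair_big /= (partition_big (@choices m) predT) //=.
apply: eq_bigr => [[a b] _]; rewrite big_distrl /=.
by apply: eq_bigr => q /eqP ->.
Qed.

Lemma servers_rcons h q : servers (rcons h q) = rcons (servers h) (srv h q).
Proof. by rewrite /servers foldl_rcons. Qed.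

Lemma size_servers (h : seq (request m)) : size (servers h) = size h.
Proof.
by elim/last_ind: h => // h q IH; rewrite servers_rcons !size_rcons IH.
Qed.

Lemma hist_load_rcons h q v : ld (rcons h q) v = (ld h v + (srv h q == v))%N.
Proof. by rewrite /ld /load servers_rcons -cats1 count_cat /= addn0. Qed.

Lemma serve_choice (hs : seq (node m)) q :
  (serve hs q == (choices q).1) || (serve hs q == (choices q).2).
Proof.
rewrite /serve; case: (choices q) => a b /=.
by do 3?case: ifP => _; rewrite eqxx ?orbT.
Qed.

Lemma serve_load_min h q :
  (ld h (srv h q) <= ld h (choices q).1)%N &&
  (ld h (srv h q) <= ld h (choices q).2)%N.
Proof.
rewrite /serve /ld; case: (choices q) => a b /=.
case: (ltngtP (load (servers h) a) (load (servers h) b)) => [l|l|e].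
- by rewrite leqnn ltnW.
- by rewrite leqnn ltnW.
- by case: (coin q); rewrite ?e leqnn.
Qed.

Lemma hist_load_mono h q v : (ld h v <= ld (rcons h q) v)%N.
Proof. by rewrite hist_load_rcons leq_addr. Qed.

(** The [p_i v] of the opening comment, as a function of the history. *)
Definition heavy_prob (i : nat) (h : seq (request m)) (v : node m) : R :=
  \sum_b nu v b * (i <= ld h b)%N%:R.

Lemma heavy_prob_ge0 i h v : 0 <= heavy_prob i h v.
Proof. by apply: sumr_ge0 => b _; rewrite mulr_ge0 ?pair_prob_ge0 ?ler0n. Qed.

Lemma heavy_prob_mono i h q v : heavy_prob i h v <= heavy_prob i (rcons h q) v.
Proof.
apply: ler_sum => b _; rewrite ler_wpM2l ?pair_prob_ge0 // ler_nat.
by case: (leqP i (ld h b)) => // ib;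
  rewrite (leq_trans ib (hist_load_mono h q b)).
Qed.

Hypothesis nu_sym : forall a b, nu a b = nu b a.

(** The served server is the less loaded of the pair, so it is heavy only if both are; symmetry of
    [nu] makes the two positions contribute equally, whence the factor 2. *)
Lemma sum_serve_heavy (phi : node m -> R) i h : (forall v, 0 <= phi v) ->
  \sum_q w q * (phi (srv h q) * (i <= ld h (srv h q))%N%:R) <=
  2 * \sum_a phi a * (i <= ld h a)%N%:R * heavy_prob i h a.
Proof.
move=> phi0; pose I a : R := (i <= ld h a)%N%:R.
have I0 a : 0 <= I a by apply: ler0n.
pose psi a b := (phi a + phi b) * (I a * I b).
apply: (@le_trans _ _ (\sum_q w q * psi (choices q).1 (choices q).2)).
  apply: ler_sum => q _; apply: ler_wpM2l => //=.
  have /andP [ma mb] := serve_load_min h q.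
  case: (leqP i (ld h (srv h q))) => [il|_]; last first.
    by rewrite mulr0 !mulr_ge0 ?addr_ge0 ?I0.
  rewrite /psi /I (leq_trans il ma) (leq_trans il mb) !mulr1.
  by case/orP: (serve_choice (servers h) q) => /eqP ->; rewrite ?lerDl ?lerDr.
rewrite (sum_choices psi) mulr_natl mulr2n /psi.
under eq_bigr do under eq_bigr do rewrite mulrDl mulrDr.
under eq_bigr do rewrite big_split /=.
rewrite big_split /= lerD //; last rewrite exchange_big /=.
  apply: ler_sum => a _; rewrite /heavy_prob big_distrr /=.
  by apply: ler_sum => b _; rewrite /I le_eqVlt; apply/orP; left; apply/eqP;
    ring.
apply: ler_sum => a _; rewrite /heavy_prob big_distrr /=.
by apply: ler_sum => b _; rewrite nu_sym /I le_eqVlt; apply/orP; left;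
  apply/eqP; ring.
Qed.

Definition sparse (i : nat) (B : R) (h : seq (request m)) : bool :=
  [forall v, heavy_prob i h v <= B].

Lemma sparse_rcons i B h q : sparse i B (rcons h q) -> sparse i B h.
Proof.
by move=> /forallP H; apply/forallP => v;
  exact: le_trans (heavy_prob_mono i h q v) (H v).
Qed.

Lemma subn_hist_load_rcons i h q v :
  (ld (rcons h q) v - i = ld h v - i + ((srv h q == v) && (i <= ld h v)))%N.
Proof. by rewrite hist_load_rcons; case: (_ == _) => /=;
  case: (leqP i (ld h v)); lia. Qed.

(** While level [i] is sparse, the [nu v]-weighted load above [i] grows on average by at most
    [2 * B ^+ 2] per request, whereas lifting [heavy_prob (i + g)] at [v] above [B'] takes a growth
    of [g * B']. This is the resulting Chernoff bound, summed over [v]. *)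
Lemma heavy_step (numax B B' : R) (i g N : nat) :
  0 < numax -> (forall a b, nu a b <= numax) ->
  \sum_(t : N.-tuple (request m) |
      sparse i B t && ~~ sparse (i + g) B' t) \prod_(q <- t) w q
  <= (m ^ 2)%N%:R *
     expR (- ((g%:R * B' - 4 * B ^+ 2 * N%:R) / (2 * numax))).
Proof.
(* An increment of [Y] below is at most [numax], so with this [th] the exponent grows by at most one
   half per request and [expR_le_half] applies. *)
move=> nm0 nm; pose th := (2 * numax)^-1.
have th0 : 0 < th by rewrite invr_gt0 mulr_gt0.
pose Y v h := \sum_a nu v a * (ld h a - i)%N%:R.
have YS v h q : Y v (rcons h q) =
    Y v h + nu v (srv h q) * (i <= ld h (srv h q))%N%:R.
  rewrite /Y (bigD1 (srv h q)) //= [in RHS](bigD1 (srv h q)) //=.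
  rewrite subn_hist_load_rcons eqxx /= natrD mulrDr -!addrA; congr (_ + _).
  rewrite addrC; congr (_ + _); apply: eq_bigr => a na.
  by rewrite subn_hist_load_rcons eq_sym (negbTE na) addn0.
(* Once [sparse] fails it fails forever, so cutting [Psi] to 0 keeps the drift
   inequality. *)
pose Psi v h := if sparse i B h
  then expR (th * Y v h - 4 * th * B ^+ 2 * (size h)%:R) else 0.
have bnd v : \sum_(t : N.-tuple (request m) |
    sparse i B t && (B' < heavy_prob (i + g) t v)) \prod_(q <- t) w q
  <= expR (- ((g%:R * B' - 4 * B ^+ 2 * N%:R) * th)).
  rewrite expRN; set K := expR _.
  apply: (@le_trans _ _ (Psi v [::] / K)); last first.
    rewrite /Psi; have -> : Y v [::] = 0.
      by apply: big1 => a _; rewrite /ld /= mulr0.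
    case: ifP => _; first by rewrite !mulr0 subrr expR0 div1r.
    by rewrite mul0r invr_ge0 expR_ge0.
  apply: supermartingale_markov => //.
  - by move=> h; rewrite /Psi; case: ifP => // _; apply: expR_ge0.
  - move=> h; rewrite {2}/Psi; case: ifP => [al|dead]; last first.
      rewrite big1 // => q _; rewrite /Psi ifF ?mulr0 //.
      by apply/negbTE/negP => /sparse_rcons; rewrite dead.
    set C := expR _; have C0 : 0 < C by apply: expR_gt0.
    pose X q := nu v (srv h q) * (i <= ld h (srv h q))%N%:R.
    have X0 q : 0 <= X q by rewrite mulr_ge0 ?pair_prob_ge0 ?ler0n.
    (* One factor [B] bounds [heavy_prob] at the served server, the other the [nu v]-mass of the
       heavy servers. *)
    have XB : \sum_q w q * X q <= 2 * B ^+ 2.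
      apply: le_trans (sum_serve_heavy i h (pair_prob_ge0 v)) _.
      rewrite ler_wpM2l // expr2.
      have hB := forallP al; have B0 := le_trans (heavy_prob_ge0 i h v) (hB v).
      apply: (@le_trans _ _ (heavy_prob i h v * B)); last exact: ler_wpM2r.
      rewrite /heavy_prob big_distrl /=; apply: ler_sum => a _.
      by rewrite ler_wpM2l ?hB // mulr_ge0 ?pair_prob_ge0 ?ler0n.
    apply: (@le_trans _ _ (\sum_q (C * expR (- (4 * th * B ^+ 2))) *
                            (w q * (1 + 2 * (th * X q))))).
      apply: ler_sum => q _; rewrite mulrCA ler_wpM2l // /Psi.
      case: ifP => _; last first.
        apply: mulr_ge0; first by rewrite mulr_ge0 ?expR_ge0 ?(ltW C0).
        by apply: addr_ge0 => //; rewrite mulr_ge0 // mulr_ge0 // ltW.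
      rewrite YS size_rcons -/(X q) -[(size h).+1%:R]natr1.
      have -> : th * (Y v h + X q) - 4 * th * B ^+ 2 * ((size h)%:R + 1) =
        (th * Y v h - 4 * th * B ^+ 2 * (size h)%:R) - 4 * th * B ^+ 2
        + th * X q by ring.
      rewrite 2!expRD -/C ler_wpM2l ?mulr_ge0 ?expR_ge0 //.
      apply: expR_le_half; rewrite mulr_ge0 ?(ltW th0) //=.
      rewrite mulrC ler_pdivrMr ?mulr_gt0 // mulKf ?pnatr_eq0 //.
      by rewrite /X; case: (_ <= _)%N; rewrite ?mulr1 // mulr0 ltW.
    rewrite -big_distrr /= -mulrA ger_pMr //.
    rewrite expRN mulrC ler_pdivrMr ?expR_gt0 // mul1r.
    under eq_bigr do rewrite mulrDr mulr1.
    rewrite big_split /= w1; apply: le_trans (expR_ge1Dx _); rewrite lerD2l.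
    under eq_bigr do rewrite mulrCA [_ * (th * _)]mulrCA mulrA.
    rewrite -big_distrr /=.
    have -> : 4 * th * B ^+ 2 = (2 * th) * (2 * B ^+ 2) by ring.
    by rewrite ler_wpM2l // mulr_ge0 // ltW.
  - exact: expR_gt0.
  move=> t /andP [sp lt]; rewrite /K /Psi sp ler_expR size_tuple.
  have -> : (g%:R * B' - 4 * B ^+ 2 * N%:R) * th =
    th * (g%:R * B') - 4 * th * B ^+ 2 * N%:R by ring.
  rewrite lerB // ler_wpM2l ?(ltW th0) //.
  apply: le_trans (_ : g%:R * heavy_prob (i + g) t v <= _).
    by rewrite ler_wpM2l ?ler0n // ltW.
  rewrite /heavy_prob /Y big_distrr /=; apply: ler_sum => a _.
  rewrite mulrCA ler_wpM2l ?pair_prob_ge0 // -natrM ler_nat.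
  by case: leqP => //; lia.
apply: le_trans (sum_union_le (I := node m)
  (F := fun v (t : N.-tuple _) => sparse i B t && (B' < heavy_prob (i + g) t
    v)) _ _) _.
- by move=> t; apply: prodr_ge0.
- move=> t /andP [sp]; rewrite /sparse negb_forall => /existsP [v nv].
  by exists v; rewrite ltNge nv andbT.
rewrite mulr_natl -card_node -sumr_const; exact: ler_sum.
Qed.

(** While level [i] is sparse, a server [v] of load at least [i] is served with probability at most
    [2 * B]; so [z] to the power of its load above [i], discounted by [expR (2 * z * B)] per
    request, is a supermartingale. *)
Lemma load_step (B z : R) (i k N : nat) :
  1 <= z ->
  \sum_(t : N.-tuple (request m) |
      sparse i B t && [exists v, (i + k <= ld t v)%N]) \prod_(q <- t) w q
  <= (m ^ 2)%N%:R * (expR (2 * z * B * N%:R) / z ^+ k).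
Proof.
move=> z1; have z0 : 0 < z by apply: lt_le_trans z1.
pose Psi v h := if sparse i B h
  then z ^+ (ld h v - i) * expR (- (2 * z * B * (size h)%:R)) else 0.
have bnd v : \sum_(t : N.-tuple (request m) |
    sparse i B t && (i + k <= ld t v)%N) \prod_(q <- t) w q
  <= expR (2 * z * B * N%:R) / z ^+ k.
  set K := z ^+ k * expR (- (2 * z * B * N%:R)).
  have K0 : 0 < K by rewrite mulr_gt0 ?expR_gt0 ?exprn_gt0.
  apply: (@le_trans _ _ (Psi v [::] / K)); last first.
    rewrite /Psi; case: ifP => _; last first.
      by rewrite mul0r mulr_ge0 ?expR_ge0 ?invr_ge0 ?exprn_ge0 ?(ltW z0).
    rewrite sub0n expr0 mul1r mulr0 oppr0 expR0 div1r /K invfM -expRN opprK.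
    by rewrite mulrC.
  apply: supermartingale_markov => //.
  - move=> h; rewrite /Psi; case: ifP => // _.
    by rewrite mulr_ge0 ?expR_ge0 ?exprn_ge0 ?(ltW z0).
  - move=> h; rewrite {2}/Psi; case: ifP => [al|dead]; last first.
      rewrite big1 // => q _; rewrite /Psi ifF ?mulr0 //.
      by apply/negbTE/negP => /sparse_rcons; rewrite dead.
    set C := z ^+ _ * _.
    have C0 : 0 < C by rewrite mulr_gt0 ?expR_gt0 ?exprn_gt0.
    pose phi a : R := (a == v)%:R.
    pose X q := phi (srv h q) * (i <= ld h (srv h q))%N%:R.
    have X0 q : 0 <= X q by rewrite mulr_ge0 ?ler0n.
    have XB : \sum_q w q * X q <= 2 * B.
      apply: le_trans (sum_serve_heavy i h _) _.
        by move=> a; apply: ler0n.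
      rewrite ler_wpM2l // (bigD1 v) //= big1 ?addr0; last first.
        by move=> a na; rewrite /phi (negbTE na) !mul0r.
      rewrite /phi eqxx mul1r; have hB := forallP al.
      case: (_ <= _)%N; rewrite ?mul1r ?hB // mul0r.
      exact: le_trans (heavy_prob_ge0 i h v) (hB v).
    apply: (@le_trans _ _ (\sum_q (C * expR (- (2 * z * B))) *
                            (w q * (1 + z * X q)))).
      apply: ler_sum => q _; rewrite mulrCA ler_wpM2l // /Psi.
      case: ifP => _; last first.
        apply: mulr_ge0; first by rewrite mulr_ge0 ?expR_ge0 ?(ltW C0).
        by apply: addr_ge0 => //; rewrite mulr_ge0 ?X0 ?(ltW z0).
      rewrite subn_hist_load_rcons size_rcons -[(size h).+1%:R]natr1 mulrDr
        mulr1 opprD expRD.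
      rewrite exprD /C -!mulrA ler_wpM2l ?exprn_ge0 ?(ltW z0) //.
      rewrite mulrC -!mulrA ler_wpM2l ?expR_ge0 // ler_wpM2l ?expR_ge0 //.
      rewrite /X /phi.
      case: eqP => [->|_] /=; last by rewrite expr0 mul0r mulr0 addr0.
      by case: (_ <= _)%N; rewrite ?expr0 ?expr1 ?mulr1 ?mulr0 ?addr0 // lerDr.
    rewrite -big_distrr /= -mulrA ger_pMr //.
    rewrite expRN mulrC ler_pdivrMr ?expR_gt0 // mul1r.
    under eq_bigr do rewrite mulrDr mulr1.
    rewrite big_split /= w1; apply: le_trans (expR_ge1Dx _); rewrite lerD2l.
    under eq_bigr do rewrite mulrCA.
    rewrite -big_distrr /=.
    have -> : 2 * z * B = z * (2 * B) by ring.
    by rewrite ler_wpM2l // ltW.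
  move=> t /andP [sp lt]; rewrite /K /Psi sp size_tuple ler_wpM2r ?expR_ge0 //.
  by apply: ler_weXn2l => //; lia.
apply: le_trans (sum_union_le (I := node m)
  (F := fun v (t : N.-tuple _) => sparse i B t && (i + k <= ld t v)%N) _ _) _.
- by move=> t; apply: prodr_ge0.
- by move=> t /andP [sp] /existsP [v nv]; exists v; rewrite sp.
rewrite mulr_natl -card_node -sumr_const; exact: ler_sum.
Qed.

End Allocation.

(** * Lower bound on the maximum load *)

Lemma expRN_le_half (R : realType) (u : R) :
  0 <= u <= 1 -> expR (- u) <= 1 - u / 2.
Proof.
move=> /andP [u0 u1]; have H := expR_ge1Dx u.
have u1' : 0 < 1 + u by lra.
apply: (@le_trans _ _ (1 + u)^-1).
  by rewrite expRN lef_pV2 // posrE ?expR_gt0.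
by rewrite -div1r ler_pdivrMr //; nra.
Qed.

Section LowerBound.
Variables (R : realType) (m : nat) (w : request m -> R).
Hypothesis w0 : forall q, 0 <= w q.
Hypothesis w1 : \sum_q w q = 1.
Implicit Types (h : seq (request m)) (q : request m) (a b v : node m).

Local Notation ld := hist_load.
Local Notation srv h q := (serve (servers h) q).
Let n : R := (m ^ 2)%N%:R.

Variables (c y : R) (l : nat).
Hypothesis m0 : (0 < m)%N.
Hypothesis c01 : 0 < c <= 1.
Hypothesis l0 : (0 < l)%N.
Hypothesis yE : y = c / (32 * l%:R).

(** Closed form of the recursion [x 0 = 1], [x i.+1 = y * x i ^+ 2]. *)
Definition level_density (i : nat) : R := y ^+ (2 ^ i - 1).
Local Notation x := level_density.

Hypothesis xl_large : 1 <= x l * n.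
Hypothesis spread : forall S : {set node m}, x l * n / 2 <= #|S|%:R ->
  c * (#|S|%:R / n) ^+ 2 <= \sum_(a in S) \sum_(b in S) pair_prob w a b.

Definition heavy_count (i : nat) h : nat := #|[set v | (i <= ld h v)%N]|.
Local Notation cnt := heavy_count.

Let n0 : 0 < n.
Proof. by rewrite ltr0n expn_gt0 m0. Qed.

Let y0 : 0 < y.
Proof. by case/andP: c01 => ? _; rewrite yE divr_gt0 // mulr_gt0 // ltr0n. Qed.

Let y32 : y <= 32^-1.
Proof.
case/andP: c01 => c0 c1; rewrite yE ler_pdivrMr ?mulr_gt0 ?ltr0n //.
rewrite mulKf ?pnatr_eq0 //; apply: le_trans c1 _.
by rewrite -[1]/1%:R ler_nat.
Qed.

Lemma level_density0 : x 0 = 1.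
Proof. by rewrite /x expn0 subnn expr0. Qed.

Lemma level_densityS i : x i.+1 = y * x i ^+ 2.
Proof.
rewrite /x -exprM -exprS; congr (_ ^+ _).
have := expn_gt0 2 i; rewrite expnS; lia.
Qed.

Lemma level_density_gt0 i : 0 < x i.
Proof. exact: exprn_gt0. Qed.

Lemma level_density_le1 i : x i <= 1.
Proof. by apply: exprn_ile1; [exact: ltW | have := y32; lra]. Qed.

(** Consequently, if level [i] is reached and level [i.+1] is not, at least half of the servers of
    load at least [i] have load exactly [i]. *)
Lemma level_density_half i : x i.+1 <= x i / 2.
Proof.
have := level_density_gt0 i; have := level_density_le1 i.
rewrite level_densityS; move: y32 y0 => ? ? ? ?; nra.
Qed.

Lemma level_density_anti i j : (i <= j)%N -> x j <= x i.
Proof.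
move=> /subnK <-; elim: (j - i)%N => //= k IH; rewrite addSn.
apply: le_trans IH; apply: le_trans (level_density_half _) _.
have := level_density_gt0 (k + i); lra.
Qed.

Lemma heavy_count0 h : cnt 0 h = (m ^ 2)%N.
Proof.
rewrite /cnt -card_node -cardsT.
by apply: eq_card => v; rewrite !inE.
Qed.

Lemma heavy_count_mono i h q : (cnt i h <= cnt i (rcons h q))%N.
Proof.
apply: subset_leq_card; apply/subsetP => v; rewrite !inE => iv.
exact: leq_trans iv (hist_load_mono h q v).
Qed.

Let ok i h := x i * n <= (cnt i h)%:R.

Let ok_rcons i h q : ok i h -> ok i (rcons h q).
Proof. by move=> /le_trans; apply; rewrite ler_nat heavy_count_mono. Qed.

(** [p i] is [c * (x i / 2) ^+ 2], which is what [spread] yields for [x i * n / 2] servers; [th] is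
    [p l], the smallest value up to level [l]. *)
Let p i := c * x i ^+ 2 / 4.
Let th := c * x l ^+ 2 / 4.

Let p0 i : 0 < p i.
Proof.
case/andP: c01 => ? _.
by rewrite divr_gt0 // mulr_gt0 // exprn_gt0 // level_density_gt0.
Qed.

Let th_le i : (i <= l)%N -> th <= p i.
Proof.
case/andP: c01 => c0 _ il; rewrite ler_pM2r ?invr_gt0 // ler_pM2l //.
by rewrite lerXn2r ?nnegrE ?(ltW (level_density_gt0 _)) // level_density_anti.
Qed.

(* [Y] increases by at least 1 per request on average until level [l] is
   reached, while it never exceeds [n / 4]. *)
Let Y h := \sum_(i < l) Num.min (cnt i.+1 h)%:R (x i.+1 * n + 1) / p i.

Let Y_mono h q : Y h <= Y (rcons h q).
Proof.
apply: ler_sum => i _; rewrite ler_pM2r ?invr_gt0 //.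
by rewrite le_min2 // ler_nat heavy_count_mono.
Qed.

Let current h : ~~ ok l h -> exists2 i : 'I_l, ok i h & ~~ ok i.+1 h.
Proof.
move=> nl; have [i [il oi noi]] : exists i, [/\ (i < l)%N, ok i h & ~~ ok i.+1
  h].
  elim: l nl => [|k IH] nk.
    by move: nk; rewrite /ok level_density0 heavy_count0 mul1r lexx.
  have [ok_k|nok] := boolP (ok k h); first by exists k.
  by have [i [ik ? ?]] := IH nok; exists i; split=> //; apply: ltnW.
by exists (Ordinal il).
Qed.

Let exact_level i h : {set node m} := [set v | ld h v == i].

Let exact_levelE i h : #|exact_level i h|%:R = (cnt i h)%:R - (cnt i.+1 h)%:R
  :> R.
Proof.
have -> : exact_level i h =
    [set v | (i <= ld h v)%N] :\: [set v | (i.+1 <= ld h v)%N].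
  by apply/setP => v; rewrite !inE eqn_leq -leqNgt.
rewrite cardsD (setIidPr _); last by apply/subsetP => v; rewrite !inE => /ltnW.
rewrite natrB // subset_leq_card //; apply/subsetP => v.
by rewrite !inE => /ltnW.
Qed.

Let hit i h q :=
  ((choices q).1 \in exact_level i h) && ((choices q).2 \in exact_level i h).

(** Whichever of the two is served moves from load [i] to [i.+1], so it is new in the count. *)
Let hit_count i h q : hit i h q -> ((cnt i.+1 h).+1 <= cnt i.+1 (rcons h q))%N.
Proof.
rewrite /hit !inE => /andP [/eqP ha /eqP hb].
have hs : ld h (srv h q) = i.
  by case/orP: (serve_choice (servers h) q) => /eqP ->.
rewrite /cnt -add1n; set A := [set v | _].
have -> : [set v | (i.+1 <= ld (rcons h q) v)%N] = srv h q |: A.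
  apply/setP => v; rewrite !inE hist_load_rcons eq_sym.
  by case: eqP => [->|_] /=; rewrite ?hs ?addn1 ?ltnSn ?addn0.
by rewrite cardsU1 inE hs ltnn.
Qed.

(** The count is still below [x i.+1 * n], so the [+ 1] in the cap of [Y] leaves room for a full
    unit and the minimum does not truncate the gain. *)
Let Y_hit (i : 'I_l) h q : ~~ ok i.+1 h -> hit i h q ->
  Y h + (p i)^-1 <= Y (rcons h q).
Proof.
rewrite /ok -ltNge => nok /hit_count hc.
rewrite /Y (bigD1 i) //= [leRHS](bigD1 i) //= addrAC lerD //; last first.
  apply: ler_sum => j _; rewrite ler_pM2r ?invr_gt0 //.
  by rewrite le_min2 // ler_nat heavy_count_mono.
rewrite -{2}[(p i)^-1]mul1r -mulrDl ler_pM2r ?invr_gt0 //.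
rewrite min_l; last by rewrite (le_trans (ltW nok)) // lerDl.
rewrite natr1 le_min ler_nat hc /= -natr1 lerD2r; exact: ltW.
Qed.

(** The exact level is a difference of two counts, and by [level_density_half] at least
    [x i * n / 2], so [spread] applies to it. *)
Let hit_prob i h : (i < l)%N -> ok i h -> ~~ ok i.+1 h ->
  p i <= \sum_q w q * (hit i h q)%:R.
Proof.
move=> il oi; rewrite /ok -ltNge => noi.
pose I a : R := (a \in exact_level i h)%:R.
have -> : \sum_q w q * (hit i h q)%:R =
    \sum_q w q * (fun a b => I a * I b) (choices q).1 (choices q).2.
  by apply: eq_bigr => q _; rewrite /hit /I -natrM mulnb.
rewrite (sum_choices w (fun a b => I a * I b)).
have -> : \sum_a \sum_b pair_prob w a b * (I a * I b) =
    \sum_(a in exact_level i h) \sum_(b in exact_level i h) pair_prob w a b.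
  rewrite [RHS]big_mkcond; apply: eq_bigr => a _; rewrite /I.
  case: (a \in _); last by apply: big1 => b _; rewrite mul0r mulr0.
  rewrite [RHS]big_mkcond; apply: eq_bigr => b _.
  by case: (b \in _); rewrite mul1r ?mulr1 ?mulr0.
have big : x i * n / 2 <= #|exact_level i h|%:R.
  rewrite exact_levelE; move: oi noi n0 (level_density_half i); rewrite /ok.
  nra.
have dx : x l <= x i / 2.
  exact: le_trans (level_density_anti il) (level_density_half i).
have xi := level_density_gt0 i.
apply: le_trans (spread _).
  have -> : p i = c * (x i / 2) ^+ 2 by rewrite /p; field.
  case/andP: c01 => c0 _; rewrite ler_pM2l // lerXn2r ?nnegrE //.
  - by rewrite divr_ge0 // ltW.
  - by rewrite divr_ge0 ?ler0n // ltW.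
  by rewrite ler_pdivlMr // mulrAC.
apply: le_trans big; rewrite ler_pM2r ?invr_gt0 // ler_pM2r //.
exact: level_density_anti (ltnW il).
Qed.

(** [Y] never exceeds [n / 4], whereas the exponential potential credits it with a drift of one half
    per request until level [l] is reached. If no server gets load [l], the gap [n / 4] times [th]
    is the exponent. *)
Lemma max_load_lower :
  \sum_(t : (m ^ 2).-tuple (request m) | [forall v, (ld t v < l)%N])
    \prod_(q <- t) w q <= expR (- (c * x l ^+ 2 * n / 16)).
Proof.
pose Psi h := if ok l h then 0 else expR (th * ((size h)%:R / 2 - Y h)).
have th0 : 0 < th := p0 l.
set K := expR (c * x l ^+ 2 * n / 16).
(* Each of the [l] terms is at most [n / (4 * l)]: [y] is chosen for this, and [xl_large] absorbs
   the [+ 1] of the cap. *)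
have Ymax h : Y h <= n / 4.
  apply: le_trans (_ : \sum_(i < l) (8 * y * n / c) <= _).
    apply: ler_sum => i _.
    rewrite ler_pdivrMr //; apply: (@le_trans _ _ (x i.+1 * n + 1)).
      by rewrite ge_min lexx orbT.
    case/andP: c01 => c0 _.
    have -> : 8 * y * n / c * p i = 2 * (x i.+1 * n).
      by rewrite /p level_densityS; field; rewrite gt_eqF.
    rewrite mulr_natl mulr2n lerD2l; apply: le_trans xl_large _.
    by rewrite ler_pM2r // level_density_anti.
  rewrite sumr_const card_ord yE -mulr_natl.
  have l0' : l%:R != 0 :> R by rewrite pnatr_eq0 -lt0n.
  case/andP: c01 => c0 _.
  rewrite le_eqVlt; apply/orP; left; apply/eqP; field.
  by rewrite l0' gt_eqF.
apply: (@le_trans _ _ (Psi [::] / K)); last first.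
  rewrite expRN -/K ler_pdivrMr ?expR_gt0 // mulVf ?gt_eqF ?expR_gt0 //.
  rewrite /Psi; case: ifP => // _; rewrite mul0r sub0r expR_le1 mulrN oppr_le0.
  rewrite mulr_ge0 ?(ltW th0) // sumr_ge0 // => i _.
  rewrite divr_ge0 ?(ltW (p0 i)) // le_min ler0n /= addr_ge0 // mulr_ge0 ?ltW
    //.
  exact: level_density_gt0.
apply: supermartingale_markov => //.
- by move=> h; rewrite /Psi; case: ifP => // _; apply: expR_ge0.
- move=> h; rewrite {2}/Psi; case: ifP => [dn|/negbT alv].
    rewrite big1 // => q _; rewrite /Psi ifT ?mulr0 //; exact: ok_rcons.
  have [i oi noi] := current alv.
  set C := expR _; have C0 : 0 < C by apply: expR_gt0.
  (* As [th <= p i], [u] lies in the unit interval and [expRN_le_half] applies; the expected loss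
     [u / 2 * p i] equals [th / 2] and pays for the factor [expR (th / 2)] of one request. *)
  pose u := th / p i.
  have u01 : 0 <= u <= 1.
    rewrite /u divr_ge0 ?(ltW th0) ?(ltW (p0 i)) //= ler_pdivrMr // mul1r.
    exact: th_le (ltnW (ltn_ord i)).
  have /andP [u0 u1] := u01.
  apply: (@le_trans _ _ (\sum_q (C * expR (th / 2)) *
                           (w q * (1 - u / 2 * (hit i h q)%:R)))).
    apply: ler_sum => q _; rewrite mulrCA ler_wpM2l // /Psi.
    have e0 : 0 <= C * expR (th / 2) by rewrite mulr_ge0 ?expR_ge0 ?(ltW C0).
    case: ifP => _.
      apply: mulr_ge0 => //; case: (hit _ _ _); rewrite ?mulr1 ?mulr0; lra.
    apply: (@le_trans _ _ (C * expR (th / 2) * expR (- (u * (hit i h q)%:R)))).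
      rewrite /C -2!expRD ler_expR size_rcons -[(size h).+1%:R]natr1.
      have yy : Y h + (p i)^-1 * (hit i h q)%:R <= Y (rcons h q).
        case hq: (hit i h q); last by rewrite mulr0 addr0 Y_mono.
        by rewrite mulr1; apply: Y_hit.
      have := ler_wpM2l (ltW th0) yy; rewrite /u mulrDr !mulrA; lra.
    rewrite ler_wpM2l //; case: (hit _ _ _); last first.
      by rewrite !mulr0 oppr0 expR0 addr0.
    by rewrite !mulr1; apply: expRN_le_half.
  rewrite -big_distrr /= -mulrA ger_pMr //.
  under eq_bigr do rewrite mulrBr mulr1 mulrCA.
  rewrite sumrB w1 -big_distrr /=.
  have hp := hit_prob (ltn_ord i) oi noi.
  have up : u * p i = th by rewrite /u mulfVK // gt_eqF.
  have -> : expR (th / 2) = (expR (- (th / 2)))^-1 by rewrite expRN invrK.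
  rewrite mulrC ler_pdivrMr ?expR_gt0 // mul1r.
  apply: le_trans (expR_ge1Dx _); rewrite lerD2l lerN2 -up.
  rewrite mulrAC; apply: ler_wpM2l hp; lra.
- exact: expR_gt0.
move=> t /forallP small; rewrite /Psi ifF; last first.
  apply/negbTE; rewrite /ok -ltNge.
  have -> : cnt l t = 0%N.
    by apply/eqP; rewrite cards_eq0; apply/eqP/setP => v;
      rewrite !inE leqNgt small.
  by rewrite mulr_gt0 // level_density_gt0.
rewrite /K ler_expR size_tuple -/n.
have -> : c * x l ^+ 2 * n / 16 = th * (n / 2 - n / 4) by rewrite /th; field.
rewrite ler_wpM2l ?(ltW th0) // lerB //.
Qed.

End LowerBound.

(** * Upper bound on the maximum load *)

Section UpperBound.
Variables (R : realType) (m : nat) (w : request m -> R).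
Hypothesis w0 : forall q, 0 <= w q.
Hypothesis w1 : \sum_q w q = 1.
Hypothesis nu_sym : forall a b, pair_prob w a b = pair_prob w b a.
Variables (C f numax : R) (g K k : nat).
Hypothesis m0 : (0 < m)%N.
Let n : R := (m ^ 2)%N%:R.
Hypothesis C0 : 0 < C.
Hypothesis row_le : forall a, \sum_b pair_prob w a b <= C / n.
Hypothesis numax0 : 0 < numax.
Hypothesis nu_le : forall a b, pair_prob w a b <= numax.
Hypothesis gC : 16 * C <= g%:R.
Hypothesis f01 : 0 < f <= 1.
Hypothesis fK : 2^-1 ^+ (2 ^ K) <= f.

Let n0 : 0 < n.
Proof. by rewrite ltr0n expn_gt0 m0. Qed.

(** Iterated squaring of one half, stopped at the floor [f], which by [fK] is reached at level
    [K]. *)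
Let gam i : R := Num.max (2^-1 ^+ (2 ^ i)) f.
Let B i : R := 2 * C * gam i / n.

Let gam0 i : 0 < gam i.
Proof. by rewrite lt_max exprn_gt0 // invr_gt0. Qed.

Let gamS i : gam i ^+ 2 <= gam i.+1.
Proof.
case/andP: f01 => f0 f1; rewrite /gam le_max expnSr exprM.
by case: (leP (2^-1 ^+ (2 ^ i)) f) => _;
  rewrite ?lexx // orbC expr2 ger_pMl ?f1.
Qed.

(** [gam 0] is at least one half, so the factor 2 in [B] lets [B 0] dominate a full row sum. *)
Let init_sparse : sparse w 0 (B 0) [::].
Proof.
apply/forallP => v; apply: (@le_trans _ _ (\sum_b pair_prob w v b)).
  by apply: ler_sum => b _; rewrite mulr1.
apply: le_trans (row_le v) _; rewrite /B ler_pM2r ?invr_gt0 //.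
have : 2^-1 <= gam 0 by rewrite le_max expn0 expr1 lexx.
by move: C0; nra.
Qed.

Let sparse0 h : sparse w 0 (B 0) h.
Proof.
apply/forallP => v; have /forallP /(_ v) := init_sparse.
by apply: le_trans; apply: ler_sum => b _; rewrite !leq0n.
Qed.

(** Either sparsity breaks at some step of the induction, which [heavy_step] makes unlikely, or
    level [g * K] stays sparse with parameter [f] and [load_step] bounds the further requests to any
    server. *)
Lemma max_load_upper :
  \sum_(t : (m ^ 2).-tuple (request m) |
      [exists v, (g * K + k <= hist_load t v)%N]) \prod_(q <- t) w q
  <= K%:R * (n * expR (- (8 * C ^+ 2 * f / (n * numax)))) +
     n * (expR (4 * C) * f ^+ k).
Proof.
case/andP: f01 => f0 f1.
pose F (i : 'I_K + unit) (t : (m ^ 2).-tuple (request m)) := match i with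
  | inl i => sparse w (g * i) (B i) t && ~~ sparse w (g * i + g) (B i.+1) t
  | inr _ => sparse w (g * K) (B K) t &&
             [exists v, (g * K + k <= hist_load t v)%N] end.
apply: le_trans (sum_union_le (F := F) _ _) _.
- by move=> t; apply: prodr_ge0.
- move=> t ex; have [sp|nsp] := boolP (sparse w (g * K) (B K) t).
    by exists (inr tt); rewrite /= sp.
  have [i [iK oi noi]] : exists i, [/\ (i < K)%N, sparse w (g * i) (B i) t
      & ~~ sparse w (g * i.+1) (B i.+1) t].
    elim: K nsp => [|j IH] nj; first by rewrite muln0 sparse0 in nj.
    have [ok_j|nok] := boolP (sparse w (g * j) (B j) t); first by exists j.
    by have [i [ij ? ?]] := IH nok; exists i; split=> //; apply: ltnW.
  by exists (inl (Ordinal iK)); rewrite /= oi -mulnSr.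
rewrite big_sumType /=; apply: lerD.
  rewrite mulr_natl -[X in _ *+ X](card_ord K) -sumr_const.
  apply: ler_sum => i _.
  apply: le_trans (heavy_step w0 w1 nu_sym (B i) (B i.+1) (g * i) g (m ^ 2)
    numax0 nu_le) _.
  rewrite -/n ler_pM2l // ler_expR lerN2.
  have -> : 8 * C ^+ 2 * f / (n * numax) = 16 * C ^+ 2 * f / n / (2 * numax).
    by move: (n) (lt0r_neq0 n0) (lt0r_neq0 numax0) => n' nn mn; field;
      rewrite nn mn.
  rewrite ler_pM2r ?invr_gt0 ?mulr_gt0 //.
  have -> : g%:R * B i.+1 - 4 * B i ^+ 2 * n =
      (g%:R * (2 * C * gam i.+1) - 16 * C ^+ 2 * gam i ^+ 2) / n.
    by rewrite /B; move: (n) (lt0r_neq0 n0) => n' nn; field.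
  rewrite ler_pM2r ?invr_gt0 //.
  have g1 := gamS i; have gf : f <= gam i.+1 by rewrite le_max lexx orbT.
  have CC : 0 < C ^+ 2 by rewrite exprn_gt0.
  (* The bound on [g] provides [32 * C ^+ 2 * gam i.+1]; since [gam i ^+ 2 <= gam i.+1], the drift
     takes at most half, and the rest is at least [16 * C ^+ 2 * f]. *)
  apply: (@le_trans _ _ (16 * C * (2 * C * gam i.+1) - 16 * C ^+ 2 * gam i ^+
    2)).
    by move: (gam i.+1) (gam i ^+ 2) g1 gf => x y g1 gf; nra.
  rewrite lerB // ler_wpM2r // !mulr_ge0 ?(ltW C0) // ltW //.
rewrite big_const card_unit /= addr0.
(* With [z] equal to [f^-1], the exponent [2 * z * B K * n] is the constant [4 * C]. *)
have z1 : 1 <= f^-1 by rewrite invf_ge1.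
apply: le_trans (load_step w0 w1 nu_sym (B K) (g * K) k (m ^ 2) z1) _.
have gK : gam K = f by rewrite /gam; apply/max_idPr.
rewrite -/n ler_pM2l // exprVn invrK ler_pM2r ?exprn_gt0 // ler_expR.
rewrite /B gK le_eqVlt; apply/orP; left; apply/eqP.
by move: (n) (lt0r_neq0 n0) (lt0r_neq0 f0) => n' nn fn; field; rewrite nn fn.
Qed.

End UpperBound.

(** * Communication cost *)

(** Weigh a request by 1/2, times 16 if it lies in [P]: one step multiplies the mean by at most
    [(1 + 15 / 16) / 2], and on the event the total weight is at least [4 ^+ N / 2 ^+ N]. *)
Lemma count_tail (R : realType) (Q : finType) (w : Q -> R) (P : pred Q)
    (N : nat) :
  (forall q, 0 <= w q) -> \sum_q w q = 1 -> \sum_(q | P q) w q <= 16^-1 ->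
  \sum_(t : N.-tuple Q | (N <= 2 * count P t)%N) \prod_(q <- t) w q
    <= (2 ^+ N)^-1.
Proof.
move=> w0 w1 wP; pose Psi (h : seq Q) : R := 16 ^+ count P h * 2 ^- size h.
have -> : (2 ^+ N)^-1 = Psi [::] / 2 ^+ N :> R.
  by rewrite /Psi /= expr0 invr1 mulr1 div1r.
apply: supermartingale_markov => //.
- by move=> h; rewrite mulr_ge0 ?invr_ge0 ?exprn_ge0.
- move=> h; pose C := Psi h.
  have C0 : 0 <= C by rewrite mulr_ge0 ?invr_ge0 ?exprn_ge0.
  have -> : \sum_q w q * Psi (rcons h q) =
      \sum_q C * (2^-1 * (w q + 15 * (if P q then w q else 0))).
    apply: eq_bigr => q _; rewrite /C /Psi size_rcons -cats1 count_cat /= addn0.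
    rewrite exprS invfM exprD; case: (P q); rewrite ?expr0 ?expr1; ring.
  rewrite -big_distrr /= -big_distrr /= big_split /= w1 -big_distrr /=.
  rewrite -big_mkcond /= -[leRHS]mulr1 ler_wpM2l //; lra.
- by rewrite exprn_gt0.
move=> t ct; rewrite /Psi size_tuple ler_pdivlMr ?exprn_gt0 //.
rewrite -exprMn; apply: (@le_trans _ _ (4 ^+ (2 * count P t))).
  rewrite -natrM; apply: ler_weXn2l => //; by rewrite ler1n.
rewrite exprM -natrX //.
Qed.

Section CommCost.
Variables (R : realType) (m : nat).
Implicit Types (h : seq (request m)) (q : request m).

Definition total_dist h : nat :=
  \sum_(x <- zip h (servers h)) tdist (origin x.1) x.2.

Lemma total_dist_rcons h q : total_dist (rcons h q) =
  (total_dist h + tdist (origin q) (serve (servers h) q))%N.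
Proof.
rewrite /total_dist servers_rcons zip_rcons ?size_servers //.
by rewrite -cats1 big_cat big_seq1.
Qed.

Lemma comm_cost_le (r : R) h : (0 < size h)%N ->
  (forall q, q \in h -> ((tdist (origin q) (choices q).1)%:R <= r) &&
                        ((tdist (origin q) (choices q).2)%:R <= r)) ->
  comm_cost R h <= r.
Proof.
move=> h0 near; rewrite /comm_cost -/(total_dist h) ler_pdivrMr ?ltr0n //.
elim/last_ind: h near {h0} => [|h q IH] near.
  by rewrite /total_dist big_nil mulr0.
rewrite total_dist_rcons size_rcons natrD -[(size h).+1%:R]natr1 mulrDr mulr1.
apply: lerD; first by apply: IH => p ph; apply: near;
  rewrite mem_rcons inE ph orbT.
have qh : q \in rcons h q by rewrite mem_rcons mem_head.
have /andP [n1 n2] := near q qh.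
by case/orP: (serve_choice (servers h) q) => /eqP ->.
Qed.

Lemma comm_cost_ge (s : R) h : 0 <= s -> (0 < size h)%N ->
  (2 * count (fun q => ((tdist (origin q) (choices q).1)%:R <= s)%R ||
                      ((tdist (origin q) (choices q).2)%:R <= s)%R) h
   <= size h)%N ->
  s / 2 <= comm_cost R h.
Proof.
set P := (fun q => _ || _) => s0 h0 cnt.
rewrite /comm_cost -/(total_dist h) ler_pdivlMr ?ltr0n //.
(* This form is proved by induction because the assumption on the count does not pass to
   prefixes. *)
have : s * ((size h)%:R - (count P h)%:R) <= (total_dist h)%:R.
  elim/last_ind: h {h0 cnt} => [|h q IH].
    by rewrite /total_dist big_nil subrr mulr0.
  rewrite total_dist_rcons size_rcons -cats1 count_cat /= addn0 !natrD.
  rewrite -[(size h).+1%:R]natr1.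
  have -> : s * ((size h)%:R + 1 - ((count P h)%:R + (P q)%:R)) =
    s * ((size h)%:R - (count P h)%:R) + s * (1 - (P q)%:R) by ring.
  apply: lerD => //; case: (boolP (P q)) => [_|].
    by rewrite subrr mulr0 ler0n.
  rewrite /P negb_or -!ltNge => /andP [/ltW n1 /ltW n2]; rewrite subr0 mulr1.
  by case/orP: (serve_choice (servers h) q) => /eqP ->.
have : 2 * (count P h)%:R <= (size h)%:R :> R by rewrite -natrM ler_nat.
move=> c1 c2; nra.
Qed.

End CommCost.

(** * Geometry of the torus *)

Section GraphDistance.
Variables (T : finType) (e : rel T).

Lemma has_walk_rcons u v v' k :
  has_walk e u v k -> e v v' -> has_walk e u v' k.+1.
Proof.
case/existsP => p /andP [pp /eqP lp] evv.
apply/existsP; exists (rcons_tuple p v'); rewrite /= rcons_path pp lp evv.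
by rewrite last_rcons eqxx.
Qed.

Lemma graph_dist_le u v k : has_walk e u v k -> (graph_dist e u v <= k)%N.
Proof.
move=> wk; case: (ltnP k #|T|) => kT; last first.
  by apply: leq_trans (find_size _ _) _; rewrite size_iota.
rewrite leqNgt; apply/negP => /(before_find 0%N).
by rewrite nth_iota // add0n wk.
Qed.

(** The default [#|T|] marks unreachability, so a smaller value is the length of an actual walk. *)
Lemma graph_dist_walk u v :
  (graph_dist e u v < #|T|)%N -> has_walk e u v (graph_dist e u v).
Proof.
rewrite /graph_dist => lt.
have := @nth_find _ 0%N (has_walk e u v) (iota 0 #|T|).
by rewrite nth_iota // add0n has_find size_iota; apply.
Qed.

Lemma has_walk_sym u v k : symmetric e -> has_walk e u v k = has_walk e v u k.
Proof.
move=> se; suff imp a b : has_walk e a b k -> has_walk e b a k.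
  by apply/idP/idP; apply: imp.
case/existsP => p /andP [pp /eqP lp].
have sz : size (rev (belast a p)) == k by rewrite size_rev size_belast
  size_tuple.
apply/existsP; exists (Tuple sz) => /=.
rewrite -{1}lp rev_path (eq_path (e' := e)) => [|x y]; last by rewrite /= se.
rewrite pp /=; case: (tval p) lp => [|x s] //= <-; first by rewrite eqxx.
by rewrite rev_cons last_rcons eqxx.
Qed.

Lemma graph_dist_sym u v : symmetric e -> graph_dist e u v = graph_dist e v u.
Proof. by move=> se; apply: eq_find => k; apply: has_walk_sym. Qed.

End GraphDistance.

(** * Sizes of balls in the torus *)

Section Torus.
Variable m : nat.
Implicit Types (u v : node m) (a b : 'I_m).

Lemma torus_adj_sym : symmetric (@torus_adj m).
Proof.
move=> u v; rewrite /torus_adj /cycle_adj.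
by rewrite ![_ == u.1]eq_sym ![_ == u.2]eq_sym [_ || (u.2 == _)]orbC
  [_ || (u.1 == _)]orbC.
Qed.

Lemma tdist_sym u v : tdist u v = tdist v u.
Proof. exact: graph_dist_sym torus_adj_sym. Qed.

(** A displacement of -1, 0 or 1 is shifted by 1 to stay in the natural numbers. *)
Lemma cycle_adj_mod a b : (a == b) || cycle_adj a b ->
  exists2 d, (d <= 2)%N & b + 1 = a + d %[mod m].
Proof.
rewrite /cycle_adj => /or3P [/eqP <-|/eqP ->|/eqP ->]; first by exists 1%N.
  by exists 2%N => //=; rewrite modnDml; congr (_ %% _)%N; lia.
by exists 0%N => //=; rewrite addn0 modn_mod addn1.
Qed.

Lemma torus_adj_coords u v : torus_adj u v ->
  ((u.1 == v.1) || cycle_adj u.1 v.1) && ((u.2 == v.2) || cycle_adj u.2 v.2).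
Proof.
by rewrite /torus_adj => /orP [] /andP [-> ->]; rewrite ?orbT.
Qed.

(** Adding up the shifted displacements along the path confines each coordinate to [2 * size p + 1]
    residues. *)
Lemma torus_path_mod u p : path (@torus_adj m) u p ->
  (exists2 d, (d <= 2 * size p)%N & (last u p).1 + size p = u.1 + d %[mod m]) /\
  (exists2 d, (d <= 2 * size p)%N & (last u p).2 + size p = u.2 + d %[mod m]).
Proof.
elim: p u => [|y p IH] u /=; first by split; exists 0%N; rewrite ?addn0.
move=> /andP [/torus_adj_coords /andP [/cycle_adj_mod [d1 l1 e1]
  /cycle_adj_mod [d2 l2 e2]] /IH [[i1 k1 f1] [i2 k2 f2]]].
split; [exists (d1 + i1)%N | exists (d2 + i2)%N].
- by rewrite mulnS leq_add.
- rewrite -addn1 addnA -modnDml f1 modnDml addnAC -modnDml e1 modnDml.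
  by rewrite addnA.
- by rewrite mulnS leq_add.
- rewrite -addn1 addnA -modnDml f2 modnDml addnAC -modnDml e2 modnDml.
  by rewrite addnA.
Qed.

(** [m * k - k] represents [- k] modulo [m]. *)
Lemma mod_shift_inj a (c k : nat) : a + k = c %[mod m] ->
  (a = (c + (m * k - k)) %% m :> nat)%N.
Proof.
move=> e; rewrite -modnDml -e modnDml -addnA subnKC; last first.
  by rewrite leq_pmull // (leq_trans _ (ltn_ord a)).
by rewrite addnC mulnC modnMDl modn_small.
Qed.

Lemma card_torus_ball_le u k : (k < m ^ 2)%N ->
  (#|[set v | (tdist u v <= k)%N]| <= (2 * k + 1) ^ 2)%N.
Proof.
move=> km; have m0 : (0 < m)%N by apply: leq_ltn_trans (ltn_ord u.1).
pose f (ij : 'I_(2 * k + 1) * 'I_(2 * k + 1)) : node m :=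
  (Ordinal (ltn_pmod (u.1 + ij.1 + (m * k - k)) m0),
   Ordinal (ltn_pmod (u.2 + ij.2 + (m * k - k)) m0)).
have <- : #|{: 'I_(2 * k + 1) * 'I_(2 * k + 1)}| = ((2 * k + 1) ^ 2)%N.
  by rewrite card_prod card_ord mulnn.
apply: leq_trans (leq_imset_card f _); apply: subset_leq_card.
apply/subsetP => v; rewrite inE => dk.
(* [k < m ^ 2] puts the distance below its default value, so the walk exists. *)
have /existsP [p /andP [pp /eqP lp]] : has_walk (@torus_adj m) u v (tdist u v).
  by apply: graph_dist_walk; rewrite card_node; apply: leq_ltn_trans km.
have [[d1 l1 e1] [d2 l2 e2]] := torus_path_mod pp.
rewrite lp size_tuple in l1 l2 e1 e2.
(* Adding [k - tdist u v] to the displacement makes the shift [k] common to all [v] of the ball. *)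
have E1 : v.1 + k = u.1 + (d1 + (k - tdist u v)) %[mod m].
  by rewrite -{1}(subnKC dk) addnA -modnDml e1 modnDml addnA.
have E2 : v.2 + k = u.2 + (d2 + (k - tdist u v)) %[mod m].
  by rewrite -{1}(subnKC dk) addnA -modnDml e2 modnDml addnA.
have b1 : (d1 + (k - tdist u v) < 2 * k + 1)%N by clear -l1 dk; lia.
have b2 : (d2 + (k - tdist u v) < 2 * k + 1)%N by clear -l2 dk; lia.
apply/imsetP; exists (Ordinal b1, Ordinal b2) => //.
rewrite /f /= [v]surjective_pairing; congr pair; apply: val_inj => /=.
  exact: mod_shift_inj.
exact: mod_shift_inj.
Qed.

Lemma iter_ordS_val a k : (iter k (@ordS m) a = (a + k) %% m :> nat)%N.
Proof.
elim: k => [|k IH] /=; first by rewrite addn0 modn_small.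
by rewrite IH -addn1 modnDml addn1 addnS.
Qed.

(** The translates of [u] by at most [j] in each coordinate are distinct because [j < m], and at
    most [2 * j] steps reach each. *)
Lemma card_torus_ball_ge u j : (j < m)%N ->
  ((j + 1) ^ 2 <= #|[set v | (tdist u v <= 2 * j)%N]|)%N.
Proof.
move=> jm; pose f (xy : 'I_(j + 1) * 'I_(j + 1)) : node m :=
  (iter xy.1 (@ordS m) u.1, iter xy.2 (@ordS m) u.2).
have finj : injective f.
  move=> [x y] [x' y'] [/(congr1 val) /= e1 /(congr1 val) /= e2].
  move: e1 e2; rewrite !iter_ordS_val => /eqP e1 /eqP e2.
  have small (z : 'I_(j + 1)) : (z < m)%N by apply: leq_trans (ltn_ord z) _;
    rewrite addn1.
  rewrite !eqn_modDl !modn_small // in e1 e2.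
  by congr pair; apply: val_inj; apply/eqP.
have <- : #|{: 'I_(j + 1) * 'I_(j + 1)}| = ((j + 1) ^ 2)%N.
  by rewrite card_prod card_ord mulnn.
rewrite -cardsT -(card_imset _ finj); apply: subset_leq_card.
apply/subsetP => v /imsetP [[x y] _ ->]; rewrite inE.
have W1 k : has_walk (@torus_adj m) u (iter k (@ordS m) u.1, u.2) k.
  elim: k => [|k IH]; last first.
    by apply: has_walk_rcons IH _; rewrite /torus_adj /cycle_adj /= !eqxx orbT.
  by apply/existsP; exists [tuple]; rewrite /= -surjective_pairing eqxx.
have W2 k : has_walk (@torus_adj m) u
    (iter x (@ordS m) u.1, iter k (@ordS m) u.2) (x + k)%N.
  elim: k => [|k IH]; first by rewrite (addn0 x).
  by rewrite (addnS x k); apply: has_walk_rcons IH _;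
    rewrite /torus_adj /cycle_adj /= !eqxx.
apply: leq_trans (graph_dist_le (W2 y)) _.
by have := ltn_ord x; have := ltn_ord y; lia.
Qed.

Lemma card_tball (R : realType) (r : R) u : 1 <= r -> r <= m%:R ->
  r ^+ 2 / 4 <= #|tball r u|%:R <= 9 * r ^+ 2.
Proof.
move=> r1 rm; have r0 : 0 <= r by lra.
have /andP [tl tu] := truncn_itv r0; set k := Num.truncn r in tl tu.
have -> : tball r u = [set v | (tdist u v <= k)%N].
  by apply/setP => v; rewrite !inE -truncn_ge_nat.
have km : (k <= m)%N by rewrite -(ler_nat R); apply: le_trans rm.
have k1 : (1 <= k)%N by rewrite /k truncn_ge_nat.
apply/andP; split.
  apply: (@le_trans _ _ ((k./2 + 1) ^ 2)%N%:R); last first.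
    rewrite ler_nat; apply: leq_trans (card_torus_ball_ge u (j := k./2) _) _.
      lia.
    apply: subset_leq_card; apply/subsetP => v; rewrite !inE; lia.
  have : r <= 2 * (k./2 + 1)%N%:R.
    apply: le_trans (ltW tu) _; rewrite -natrM ler_nat; lia.
  by rewrite natrX; nra.
(* On a single node [k] equals [m ^ 2], outside the range of [card_torus_ball_le]; the number of
   nodes is bound enough. *)
have [m1|m1] := leqP m 1.
  apply: (@le_trans _ _ 1%:R); last by rewrite mulr1n; nra.
  rewrite ler_nat; apply: leq_trans (max_card _) _; rewrite card_node.
  by case: (m) m1 => [|[|?]].
apply: (@le_trans _ _ ((2 * k + 1) ^ 2)%N%:R).
  by rewrite ler_nat; apply: card_torus_ball_le; nia.
rewrite natrX natrD natrM; have := ler0n R k; nra.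
Qed.

End Torus.

(** * Random placements *)

Section Placement.
Variables (R : realType) (m M : nat).
Hypothesis m0 : (0 < m)%N.
Let n : R := (m ^ 2)%N%:R.

Let n0 : 0 < n.
Proof. by rewrite ltr0n expn_gt0 m0. Qed.

Definition cache_weight (t : M.-tuple (file m)) : R :=
  \prod_(j <- t) popularity R j.
Local Notation tw := cache_weight.
Local Notation pw := (@placement_weight R m M).

Lemma cache_weight_ge0 t : 0 <= tw t.
Proof. by apply: prodr_ge0 => j _; rewrite invr_ge0 ler0n. Qed.

Lemma placement_weight_ge0 pl : 0 <= pw pl.
Proof. by apply: prodr_ge0 => v _; apply: cache_weight_ge0. Qed.

Lemma placement_expect (phi : node m -> M.-tuple (file m) -> R) :
  \sum_(pl : placement m M) pw pl * \prod_v phi v (pl v) =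
  \prod_v \sum_t tw t * phi v t.
Proof. by rewrite bigA_distr_bigA; apply: eq_bigr => pl _;
  rewrite -big_split. Qed.

Lemma cache_all_prob (P : pred (file m)) :
  \sum_t tw t * (all P t)%:R = (#|P|%:R / n) ^+ M.
Proof.
have -> : #|P|%:R / n = \sum_j popularity R j * (P j)%:R.
  rewrite /popularity -big_distrr /= mulrC -natr_sum; congr (_ * _%:R).
  by rewrite -sum1_card big_mkcond; apply: eq_bigr => j _; rewrite unfold_in;
    case: (P j).
rewrite -sum_tuple_prod; apply: eq_bigr => t _; rewrite big_split /=.
congr (_ * _); elim: (tval t) => [|j s IH] /=; first by rewrite big_nil.
by rewrite big_cons -IH; case: (P j); rewrite ?mul1r ?mul0r.
Qed.

Lemma cache_weight_sum : \sum_t tw t = 1.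
Proof.
have := cache_all_prob predT; rewrite card_ord divff ?gt_eqF // expr1n => <-.
by apply: eq_bigr => t _; rewrite all_predT mulr1.
Qed.

Lemma placement_weight_sum : \sum_pl pw pl = 1.
Proof.
transitivity (\sum_pl pw pl * \prod_(v : node m) 1).
  by apply: eq_bigr => pl _; rewrite big1_eq mulr1.
rewrite (placement_expect (fun _ _ => 1)) big1 // => v _.
by under eq_bigr do rewrite mulr1; apply: cache_weight_sum.
Qed.

(** The probability that a given cache holds a given file. *)
Definition hit_rate : R := 1 - (1 - n^-1) ^+ M.
Local Notation p := hit_rate.

Lemma cache_hit (j : file m) (z : R) :
  \sum_t tw t * (if j \in t then z else 1) = 1 + (z - 1) * p.
Proof.
have e (t : M.-tuple (file m)) : tw t * (if j \in t then z else 1) =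
    z * tw t + (1 - z) * (tw t * (all (predC1 j) t)%:R).
  have -> : all (predC1 j) t = (j \notin t).
    by rewrite all_predC has_pred1.
  by case: (j \in t); rewrite /= ?mulr1 ?mulr0; ring.
under eq_bigr do rewrite e.
rewrite big_split /= -!big_distrr /= cache_weight_sum cache_all_prob cardC1
  card_ord.
rewrite /p.
have -> : (m ^ 2).-1%:R / n = 1 - n^-1.
  rewrite -subn1 natrB ?expn_gt0 ?m0 // -/n mulrBl divff ?gt_eqF //.
  by rewrite div1r.
ring.
Qed.

Let n1 : n^-1 <= 1.
Proof. by rewrite invf_le1 // ler1n expn_gt0 m0. Qed.

Lemma hit_rate_le : p <= M%:R / n.
Proof.
suff : 1 - M%:R / n <= (1 - n^-1) ^+ M by rewrite /p; lra.
elim: M => [|k IH]; first by rewrite mul0r subr0 expr0.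
rewrite exprS -natr1; have k0 := ler0n R k.
apply: le_trans (_ : (1 - n^-1) * (1 - k%:R / n) <= _).
  have ni0 : 0 <= n^-1 by rewrite invr_ge0 ltW.
  have : 0 <= n^-1 * (k%:R / n) by rewrite !mulr_ge0.
  by move=> ?; lra.
by rewrite ler_wpM2l // subr_ge0.
Qed.

Lemma hit_rate_ge : M%:R <= n -> M%:R / n / 2 <= p.
Proof.
move=> Mn; have H : expR (- (M%:R / n)) <= 1 - M%:R / n / 2.
  by apply: expRN_le_half;
    rewrite divr_ge0 ?ler0n ?(ltW n0) //= ler_pdivrMr // mul1r.
suff : (1 - n^-1) ^+ M <= expR (- (M%:R / n)) by rewrite /p; lra.
rewrite -mulrN expRM_natl; apply: lerXn2r;
  rewrite ?nnegrE ?expR_ge0 ?subr_ge0 //.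
exact: expR_ge1Dx.
Qed.

Lemma hit_rate_ge0 : 0 <= p.
Proof.
rewrite /p subr_ge0 exprn_ile1 ?subr_ge0 // gerBl invr_ge0 ltW //.
Qed.

Variable r : R.

(** The servers of the ball are candidates independently with probability [hit_rate]; this is the
    generating function of a binomial variable. *)
Lemma candidates_expect (u : node m) (j : file m) (z : R) :
  \sum_pl pw pl * z ^+ #|candidates r pl u j| =
  (1 + (z - 1) * p) ^+ #|tball r u|.
Proof.
pose phi v (t : M.-tuple (file m)) :=
  if v \in tball r u then if j \in t then z else 1 else 1.
transitivity (\sum_pl pw pl * \prod_v phi v (pl v)).
  apply: eq_bigr => pl _; congr (_ * _); rewrite -prodr_const big_mkcond /=.
  by apply: eq_bigr => v _; rewrite /phi !inE; case: (_ <= r).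
rewrite placement_expect -prodr_const [RHS]big_mkcond; apply: eq_bigr => v _.
rewrite /phi; case: (v \in _); first exact: cache_hit.
by under eq_bigr do rewrite mulr1; apply: cache_weight_sum.
Qed.

Lemma placement_markov (E : pred (placement m M)) (X : placement m M -> R) (K :
  R) :
  0 < K -> (forall pl, 0 <= X pl) -> (forall pl, E pl -> K <= X pl) ->
  \sum_(pl | E pl) pw pl <= (\sum_pl pw pl * X pl) / K.
Proof.
move=> K0 X0 EX;
  rewrite ler_pdivlMr // mulr_suml [leRHS](bigID E) /= -[leLHS]addr0.
apply: lerD; last by apply: sumr_ge0 => pl _;
  rewrite mulr_ge0 ?placement_weight_ge0.
by apply: ler_sum => pl Epl; rewrite ler_wpM2l ?placement_weight_ge0 ?EX.
Qed.

Hypothesis r1 : 1 <= r.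
Hypothesis rm : r <= m%:R.
Hypothesis Mn : (M ^ 2 <= m ^ 2)%N.

(** The [lam] of the opening comment: by [pB_ge] and [pB_le], the mean number of candidates up to
    constants. *)
Definition density : R := M%:R * r ^+ 2 / n.
Local Notation lam := density.

Let M_le_n : M%:R <= n.
Proof. by rewrite ler_nat; apply: leq_trans Mn; rewrite -mulnn;
  case: (M) => // k; rewrite leq_pmulr. Qed.

Let pB_ge (u : node m) : lam / 8 <= p * #|tball r u|%:R.
Proof.
have /andP [b1 _] := card_tball u r1 rm.
have -> : lam / 8 = (M%:R / n / 2) * (r ^+ 2 / 4).
  by rewrite /lam; field; rewrite ?expf_neq0 ?pnatr_eq0 -?lt0n.
apply: ler_pM (hit_rate_ge M_le_n) b1;
  first by rewrite !divr_ge0 ?ler0n ?(ltW n0).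
by rewrite divr_ge0 ?exprn_ge0 //; move: r1; lra.
Qed.

Let pB_le (u : node m) : p * #|tball r u|%:R <= 9 * lam.
Proof.
have /andP [_ b2] := card_tball u r1 rm.
apply: le_trans (ler_pM hit_rate_ge0 (ler0n _ _) hit_rate_le b2) _.
by rewrite /lam le_eqVlt; apply/orP; left; apply/eqP; field;
  rewrite ?expf_neq0 ?pnatr_eq0 -?lt0n.
Qed.

(** Chernoff with [z = expR (2^-1)]: as [z - 1 <= 1], the generating function is at most
    [expR (9 * lam)], against a threshold of [expR (18 * lam)]. *)
Lemma candidates_upper_tail (u : node m) (j : file m) :
  \sum_(pl | 36 * lam < #|candidates r pl u j|%:R) pw pl <= expR (- (9 * lam)).
Proof.
have h2 := expR_half_le2 R.
apply: le_trans (placement_markov (K := expR (18 * lam))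
  (X := fun pl => expR (2^-1) ^+ #|candidates r pl u j|) _ _ _) _.
- exact: expR_gt0.
- by move=> pl; rewrite exprn_ge0 ?expR_ge0.
- by move=> pl lt; rewrite -expRM_natl ler_expR; lra.
rewrite candidates_expect ler_pdivrMr ?expR_gt0 // -expRD.
apply: (@le_trans _ _ (expR p ^+ #|tball r u|)).
  have p0 := hit_rate_ge0; have e1 : 1 <= expR (2^-1 : R).
    by apply: le_trans (expR_ge1Dx _); rewrite lerDl invr_ge0.
  apply: lerXn2r; rewrite ?nnegrE ?expR_ge0 //; first nra.
  apply: le_trans (expR_ge1Dx _); nra.
rewrite -expRM_natl ler_expR; have := pB_le u; rewrite mulrC; lra.
Qed.

(** Chernoff with [z = expR (- 1)]: as [z <= 2^-1], the generating function is at most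
    [expR (- (lam / 16))]. *)
Lemma candidates_lower_tail (u : node m) (j : file m) :
  \sum_(pl | #|candidates r pl u j|%:R < lam / 32) pw pl <= expR (- (lam / 32)).
Proof.
have h2 : expR (- 1 : R) <= 2^-1.
  by have := @expRN_le_half R 1; rewrite ler01 lexx => /(_ isT); lra.
apply: le_trans (placement_markov (K := expR (- (lam / 32)))
  (X := fun pl => expR (- 1) ^+ #|candidates r pl u j|) _ _ _) _.
- exact: expR_gt0.
- by move=> pl; rewrite exprn_ge0 ?expR_ge0.
- by move=> pl lt; rewrite -expRM_natl ler_expR; lra.
rewrite candidates_expect ler_pdivrMr ?expR_gt0 // -expRD.
apply: (@le_trans _ _ (expR (- (p / 2)) ^+ #|tball r u|)).
  have p0 := hit_rate_ge0; have e0 := expR_gt0 (- 1 : R).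
  have p1 : p <= 1.
    by apply: le_trans hit_rate_le _; rewrite ler_pdivrMr // mul1r.
  apply: lerXn2r; rewrite ?nnegrE ?expR_ge0 //; first nra.
  apply: le_trans (expR_ge1Dx _); nra.
rewrite -expRM_natl ler_expR; have := pB_ge u; rewrite mulrC; lra.
Qed.

Lemma distinct_tail (v : node m) (k : nat) : (2 * k <= M)%N ->
  \sum_(pl : placement m M | (#|[set j | j \in pl v]| < k)%N) pw pl <= 4^-1 ^+
    k.
Proof.
move=> kM; have fm0 : (0 < m ^ 2)%N by rewrite expn_gt0 m0.
pose j0 : file m := Ordinal fm0.
(* A cache with fewer than [k] distinct files is covered by some [k]-tuple. *)
apply: le_trans (sum_union_le (I := k.-tuple (file m))
  (F := fun s (pl : placement m M) => all (mem s) (pl v)) placement_weight_ge0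
    _) _.
  move=> pl lt; have sz : size (undup (pl v)) = #|[set j | j \in pl v]|.
    rewrite -(card_uniqP (undup_uniq _)); apply: eq_card => j.
    by rewrite mem_undup inE.
  have szk : size (undup (pl v) ++ nseq (k - size (undup (pl v))) j0) == k.
    by rewrite size_cat size_nseq subnKC // sz ltnW.
  exists (Tuple szk); apply/allP => j jin.
  by rewrite inE mem_cat mem_undup jin.
(* From [2 * k <= M] and [M ^ 2 <= m ^ 2]. The union over all [k]-tuples costs at most
   [(n * (k / n) ^ 2) ^ k], and this bounds the base by 1/4. *)
have kn : (4 * (k * k) <= m ^ 2)%N by apply: leq_trans Mn; nia.
have kn1 : k%:R / n <= 1.
  by rewrite ler_pdivrMr // mul1r ler_nat; nia.
apply: (@le_trans _ _ (\sum_(s : k.-tuple (file m)) (k%:R / n) ^+ (2 * k))).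
  apply: ler_sum => s _.
  have -> : \sum_(pl : placement m M | all (mem s) (pl v)) pw pl = (#|mem s|%:R
    / n) ^+ M.
    pose phi v' (t : M.-tuple (file m)) : R :=
      if v' == v then (all (mem s) t)%:R else 1.
    transitivity (\sum_pl pw pl * \prod_v' phi v' (pl v')).
      rewrite big_mkcond; apply: eq_bigr => pl _.
      rewrite (bigD1 v) //= {1}/phi eqxx big1 ?mulr1; last first.
        by move=> v' nv; rewrite /phi (negbTE nv).
      by case: all; rewrite ?mulr1 ?mulr0.
    rewrite placement_expect (bigD1 v) //= [X in _ * X]big1 ?mulr1; last first.
      move=> v' nv; rewrite /phi (negbTE nv).
      by under eq_bigr do rewrite mulr1; apply: cache_weight_sum.
    rewrite -cache_all_prob; apply: eq_bigr => t _; by rewrite /phi eqxx.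
  apply: (@le_trans _ _ ((k%:R / n) ^+ M)).
    apply: lerXn2r; rewrite ?nnegrE ?divr_ge0 ?ler0n ?(ltW n0) //.
    rewrite ler_pM2r ?invr_gt0 // ler_nat -[leqRHS](size_tuple s).
    exact: card_size.
  by apply: ler_wiXn2l; rewrite ?divr_ge0 ?ler0n ?(ltW n0).
rewrite sumr_const card_tuple card_ord -[_ *+ (_ ^ k)%N]mulr_natl natrX -/n
  exprM -exprMn.
apply: lerXn2r; rewrite ?nnegrE ?invr_ge0 //.
  by rewrite mulr_ge0 ?(ltW n0) // exprn_ge0 // divr_ge0 ?ler0n ?(ltW n0).
have -> : n * (k%:R / n) ^+ 2 = (k * k)%N%:R / n.
  by rewrite natrM; field; rewrite ?expf_neq0 ?pnatr_eq0 -?lt0n.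
rewrite ler_pdivrMr // mulrC ler_pdivlMr // mulrC -natrM ler_nat; exact: kn.
Qed.

Definition good_placement (pl : placement m M) : bool :=
  [forall u, forall j, lam / 32 <= #|candidates r pl u j|%:R <= 36 * lam] &&
  [forall v, (M./2 <= #|[set j | j \in pl v]|)%N].

Lemma good_placement_whp :
  \sum_(pl | ~~ good_placement pl) pw pl <=
  n ^+ 2 * (expR (- (9 * lam)) + expR (- (lam / 32))) + n * 4^-1 ^+ M./2.
Proof.
pose F (i : (node m * file m) + node m) (pl : placement m M) :=
  match i with
  | inl (u, j) => (36 * lam < #|candidates r pl u j|%:R) ||
                  (#|candidates r pl u j|%:R < lam / 32)
  | inr v => (#|[set j | j \in pl v]| < M./2)%N
  end.
apply: le_trans (sum_union_le (F := F) placement_weight_ge0 _) _.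
  move=> pl; rewrite negb_and !negb_forall => /orP [/existsP [u]|/existsP [v
    nv]].
    rewrite negb_forall => /existsP [j nj]; exists (inl (u, j)) => /=.
    by move: nj; rewrite negb_and -!ltNge orbC.
  by exists (inr v); rewrite /= ltnNge.
rewrite big_sumType /=; apply: lerD; last first.
  have -> : n = #|node m|%:R by rewrite card_node.
  rewrite mulr_natl -sumr_const.
  by apply: ler_sum => v _; apply: distinct_tail; lia.
have -> : n ^+ 2 = #|{: node m * file m}|%:R.
  by rewrite card_prod card_node card_ord natrM.
rewrite [leRHS]mulr_natl -sumr_const; apply: ler_sum => [[u j] _] /=.
apply: le_trans (lerD (candidates_upper_tail u j) (candidates_lower_tail u j)).
rewrite big_mkcond [X in _ <= X + _]big_mkcond [X in _ <= _ + X]big_mkcond.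
rewrite -big_split /=; apply: ler_sum => pl _.
have pl0 := placement_weight_ge0 pl.
by case: (_ < _); case: (_ < _); rewrite /= ?addr0 ?add0r ?lerDl.
Qed.

End Placement.

(** * Sampling under a good placement *)

(** 576 is [36 * 16], from the bounds on [#|A u j|] and [occ] used in [pair_prob_spread]; the factor
    2 is lost to the distinctness of the sampled pair. *)
Definition spread_const (R : realType) : R := (2 * 576 ^+ 2)^-1.

Lemma spread_const01 (R : realType) : 0 < spread_const R <= 1.
Proof.
rewrite /spread_const invr_gt0 mulr_gt0 ?exprn_gt0 //=.
by rewrite invf_le1 ?mulr_gt0 ?exprn_gt0 //; lra.
Qed.

Section Sampling.
Variables (R : realType) (m M : nat) (r : R).
Variable mu : placement m M -> node m -> file m -> node m * node m -> R.
Variable pl : placement m M.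
Hypothesis m0 : (0 < m)%N.
Hypothesis r1 : 1 <= r.
Hypothesis rm : r <= m%:R.
Hypothesis law : two_choices_law r mu.
Hypothesis good : good_placement r pl.
Hypothesis lam64 : 64 <= density m M r.
Hypothesis M2 : (2 <= M)%N.

Let n : R := (m ^ 2)%N%:R.
Local Notation lam := (density m M r).
Local Notation A := (candidates r pl).
Local Notation w := (request_weight mu pl).
Local Notation nu := (pair_prob w).

Let n0 : 0 < n.
Proof. by rewrite ltr0n expn_gt0 m0. Qed.

Let lam0 : 0 < lam.
Proof. by apply: lt_le_trans lam64; rewrite ltr0n. Qed.

Let lamE : lam * n = M%:R * r ^+ 2.
Proof. by rewrite /density mulfVK // gt_eqF. Qed.

Let cardA_ge u j : lam / 32 <= #|A u j|%:R.
Proof. by case/andP: good => /forallP /(_ u) /forallP /(_ j) /andP []. Qed.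

Let cardA_le u j : #|A u j|%:R <= 36 * lam.
Proof. by case/andP: good => /forallP /(_ u) /forallP /(_ j) /andP []. Qed.

Let cardA2 u j : (2 <= #|A u j|)%N.
Proof. by rewrite -(ler_nat R); have := cardA_ge u j; move: lam64; lra. Qed.

Let cardA0 u j : 0 < #|A u j|%:R :> R.
Proof. by rewrite ltr0n; apply: leq_trans (cardA2 u j). Qed.

Let cardA_inv u j : #|A u j|%:R^-1 <= 32 / lam.
Proof.
rewrite -div1r ler_pdivrMr // mulrAC ler_pdivlMr // mul1r.
by have := cardA_ge u j; lra.
Qed.

Let muE u j a b : mu pl u j (a, b) =
  if [&& a \in A u j, b \in A u j & a != b]
  then (#|A u j| * (#|A u j| - 1))%N%:R^-1 else 0.
Proof. by have [_ _] := law pl u j; apply. Qed.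

Let mu_sym u j a b : mu pl u j (a, b) = mu pl u j (b, a).
Proof. by rewrite !muE eq_sym andbCA. Qed.

(** The [#|A u j| - 1] partners of [a] cancel one factor of the pair count: each choice alone is
    uniform. *)
Let mu_marginal u j a :
  \sum_b mu pl u j (a, b) = (a \in A u j)%:R / #|A u j|%:R.
Proof.
case: (boolP (a \in A u j)) => aA; last first.
  by rewrite mul0r big1 // => b _; rewrite muE (negbTE aA).
rewrite mul1r (eq_bigr (fun b => if b \in A u j :\ a then
  (#|A u j| * (#|A u j| - 1))%N%:R^-1 else 0)); last first.
  by move=> b _; rewrite muE aA /= !inE eq_sym andbC.
rewrite -big_mkcond sumr_const [#|A u j|](cardsD1 a) aA /=.
have : (0 < #|A u j :\ a|)%N by move: (cardA2 u j); rewrite (cardsD1 a) aA.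
set k := #|_ :\ a| => k0;
  rewrite addKn natrM -[_^-1 *+ k]mulr_natr invfM mulfVK //.
by rewrite pnatr_eq0 -lt0n.
Qed.

Lemma request_weight_ge0 q : 0 <= w q.
Proof.
have [mu0 _ _] := law pl (origin q) (wanted q).
by rewrite /request_weight /popularity !mulr_ge0 ?invr_ge0 ?ler0n.
Qed.

Lemma request_expect (F : node m -> file m -> node m * node m -> R) :
  \sum_q w q * F (origin q) (wanted q) (choices q) =
  n ^- 2 * \sum_u \sum_j \sum_ab mu pl u j ab * F u j ab.
Proof.
transitivity (\sum_u \sum_j \sum_ab \sum_(b : bool)
    w (u, j, ab, b) * F u j ab).
  by rewrite !pair_big /=; apply: eq_bigr => [[[[u j] ab] b] _].
rewrite big_distrr; apply: eq_bigr => u _; rewrite big_distrr.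
apply: eq_bigr => j _; rewrite big_distrr; apply: eq_bigr => ab _ /=.
rewrite big_bool /request_weight /popularity /origin /wanted /choices /= -/n.
by move: (n) (lt0r_neq0 n0) => n' nn; field.
Qed.

Lemma request_weight_sum : \sum_q w q = 1.
Proof.
rewrite (eq_bigr (fun q => w q * 1)); last by move=> q _; rewrite mulr1.
rewrite (request_expect (fun _ _ _ => 1)).
rewrite (eq_bigr (fun u => n)) => [|u _]; last first.
  rewrite (eq_bigr (fun=> 1)) => [|j _]; first by rewrite sumr_const card_ord.
  have [_ mu1 _] := law pl u j; rewrite -[RHS]mu1.
  by apply: eq_bigr => ab _; rewrite mulr1.
rewrite sumr_const card_node -mulr_natl -/n -expr2 mulVf // expf_neq0 //.
by rewrite gt_eqF.
Qed.

Let sum_pair (G : node m * node m -> R) :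
  \sum_ab G ab = \sum_a \sum_b G (a, b).
Proof. by rewrite pair_bigA; apply: eq_bigr => [[a b] _]. Qed.

Lemma first_choice_expect (F : node m -> node m -> R) :
  \sum_q w q * F (origin q) (choices q).1 =
  n ^- 2 * \sum_u \sum_j \sum_(a in A u j) F u a / #|A u j|%:R.
Proof.
rewrite (request_expect (fun u _ ab => F u ab.1)); congr (_ * _).
apply: eq_bigr => u _; apply: eq_bigr => j _.
rewrite sum_pair /= [RHS]big_mkcond; apply: eq_bigr => a _.
rewrite -big_distrl /= mu_marginal.
by case: (a \in A u j); rewrite ?mul0r // mul1r mulrC.
Qed.

Lemma second_choice_expect (F : node m -> node m -> R) :
  \sum_q w q * F (origin q) (choices q).2 =
  \sum_q w q * F (origin q) (choices q).1.
Proof.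
rewrite (request_expect (fun u _ ab => F u ab.2)).
rewrite (request_expect (fun u _ ab => F u ab.1)); congr (_ * _).
apply: eq_bigr => u _; apply: eq_bigr => j _.
rewrite !sum_pair exchange_big /=; apply: eq_bigr => a _; apply: eq_bigr => b _.
by rewrite mu_sym.
Qed.

Lemma pair_probE a b : nu a b = n ^- 2 * \sum_u \sum_j mu pl u j (a, b).
Proof.
have := request_expect (fun _ _ ab => (ab == (a, b))%:R).
have -> : \sum_q w q * (choices q == (a, b))%:R = nu a b.
  rewrite /pair_prob [RHS]big_mkcond; apply: eq_bigr => q _.
  by case: eqP; rewrite ?mulr1 ?mulr0.
move=> ->; congr (_ * _); apply: eq_bigr => u _; apply: eq_bigr => j _.
rewrite (bigD1 (a, b)) //= eqxx mulr1 big1 ?addr0 // => ab nab.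
by rewrite (negbTE nab) mulr0.
Qed.

Lemma pair_prob_sym a b : nu a b = nu b a.
Proof.
rewrite !pair_probE; congr (_ * _).
by apply: eq_bigr => u _; apply: eq_bigr => j _; rewrite mu_sym.
Qed.

Lemma card_files_le v : (#|[set j | j \in pl v]| <= M)%N.
Proof.
rewrite -[leqRHS](size_tuple (pl v)); apply: leq_trans (card_size _).
by apply: subset_leq_card; apply/subsetP => j; rewrite inE.
Qed.

Let card_files_ge v : M%:R / 4 <= #|[set j | j \in pl v]|%:R :> R.
Proof.
case/andP: good => _ /forallP /(_ v) H.
apply: (@le_trans _ _ (M./2)%:R); last by rewrite ler_nat.
rewrite ler_pdivrMr // -natrM ler_nat; move: M2; lia.
Qed.

(** By symmetry of the distance, the centres [u] whose ball contains [v] form a ball around [v]. *)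
Lemma holders_count (s : R) v :
  \sum_u \sum_j ((v \in tball s u) && (j \in pl v))%:R =
  #|tball s v|%:R * #|[set j | j \in pl v]|%:R :> R.
Proof.
rewrite -!sum1_card !natr_sum big_distrlr /= [RHS]big_mkcond.
apply: eq_bigr => u _; rewrite !inE tdist_sym; case: (_ <= s); last first.
  by rewrite big1.
rewrite [RHS]big_mkcond; apply: eq_bigr => j _; rewrite !inE /=.
by case: (j \in pl v); rewrite ?mulr1.
Qed.

(** Counts the pairs of origin and file for which [v] is a candidate; of order [lam * n] here. *)
Let occ v : R := \sum_u \sum_j (v \in A u j)%:R.

Let occE v : occ v = #|tball r v|%:R * #|[set j | j \in pl v]|%:R.
Proof.
rewrite -holders_count; apply: eq_bigr => u _; apply: eq_bigr => j _.
by rewrite !inE.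
Qed.

Let occ_le v : occ v <= 9 * (lam * n).
Proof.
have /andP [_ b2] := card_tball v r1 rm; rewrite occE lamE.
have -> : 9 * (M%:R * r ^+ 2) = (9 * r ^+ 2) * M%:R by ring.
by apply: ler_pM; rewrite ?ler0n // ler_nat card_files_le.
Qed.

Let occ_ge v : lam * n / 16 <= occ v.
Proof.
have /andP [b1 _] := card_tball v r1 rm; rewrite occE lamE.
have -> : M%:R * r ^+ 2 / 16 = (r ^+ 2 / 4) * (M%:R / 4) by field.
apply: ler_pM => //; rewrite divr_ge0 ?ler0n ?exprn_ge0 //.
by move: r1; lra.
Qed.

(** A row sum is the probability that the first choice is [a]: at most [9 * lam * n] of the [n ^ 2]
    pairs of origin and file allow it, each with probability at most [32 / lam]. *)
Lemma pair_prob_row_le a : \sum_b nu a b <= 288 / n.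
Proof.
have -> : \sum_b nu a b = \sum_q w q * (fun _ a' => (a' == a)%:R) (origin q)
  (choices q).1.
  rewrite (sum_choices w (fun a' _ => (a' == a)%:R)) /= [RHS](bigD1 a) //=.
  rewrite [X in _ = _ + X]big1 ?addr0; last first.
    by move=> a' na; apply: big1 => b _; rewrite (negbTE na) mulr0.
  by apply: eq_bigr => b _; rewrite eqxx mulr1.
rewrite (first_choice_expect (fun _ a' => (a' == a)%:R)).
apply: (@le_trans _ _ (n ^- 2 * (occ a * (32 / lam)))).
  rewrite ler_wpM2l ?invr_ge0 ?exprn_ge0 ?(ltW n0) // /occ big_distrl /=.
  apply: ler_sum => u _; rewrite big_distrl /=; apply: ler_sum => j _.
  case: (boolP (a \in A u j)) => aA; last first.
    rewrite mul0r big1 // => a' a'A; case: eqP => [e|_]; last by rewrite mul0r.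
    by rewrite -e a'A in aA.
  rewrite (bigD1 a) //= eqxx !mul1r big1 ?addr0 //= => a' /andP [_ /negbTE ->].
  by rewrite mul0r.
apply: (@le_trans _ _ (n ^- 2 * (9 * (lam * n) * (32 / lam)))).
  rewrite ler_wpM2l ?invr_ge0 ?exprn_ge0 ?(ltW n0) //.
  by rewrite ler_wpM2r // divr_ge0 ?(ltW lam0).
rewrite le_eqVlt; apply/orP; left; apply/eqP.
move: n0 lam0; rewrite !lt0r => /andP [nn _] /andP [ln _].
by move: (n) (lam) nn ln => n' l' nn ln; field; rewrite nn ln.
Qed.

(** As for the row sums, with [#|A| * (#|A| - 1)] at least half of [#|A| ^ 2], hence at least
    [lam ^+ 2 / 2048]. *)
Lemma pair_prob_le a b : nu a b <= 9 * 2048 / (n * lam).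
Proof.
rewrite pair_probE.
apply: (@le_trans _ _ (n ^- 2 * (occ a * (2048 / lam ^+ 2)))).
  rewrite ler_wpM2l ?invr_ge0 ?exprn_ge0 ?(ltW n0) // /occ big_distrl /=.
  apply: ler_sum => u _; rewrite big_distrl /=; apply: ler_sum => j _.
  have e0 : 0 <= 2048 / lam ^+ 2 by rewrite divr_ge0 ?exprn_ge0 ?(ltW lam0).
  rewrite muE; case: ifP => [/and3P [-> _ _]|_];
    last by rewrite mulr_ge0 ?ler0n.
  rewrite mul1r -[2048 / _]invrK invf_div lef_pV2 ?posrE; last 2 first.
  - by rewrite ltr0n muln_gt0 subn_gt0 (cardA2 u j) (ltnW (cardA2 u j)).
  - by rewrite divr_gt0 ?exprn_gt0.
  rewrite natrM natrB ?(ltnW (cardA2 u j)) //.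
  have c2 : 2 <= #|A u j|%:R :> R by rewrite (ler_nat R 2) cardA2.
  have := cardA_ge u j; move: lam0; nra.
apply: (@le_trans _ _ (n ^- 2 * (9 * (lam * n) * (2048 / lam ^+ 2)))).
  rewrite ler_wpM2l ?invr_ge0 ?exprn_ge0 ?(ltW n0) //.
  by rewrite ler_wpM2r // divr_ge0 ?exprn_ge0 ?(ltW lam0).
rewrite le_eqVlt; apply/orP; left; apply/eqP.
move: n0 lam0; rewrite !lt0r => /andP [nn _] /andP [ln _].
by move: (n) (lam) nn ln => n' l' nn ln; field; rewrite nn ln.
Qed.

(** With [f u j] the share of the candidates lying in [S], both choices fall in [S] with probability
    at least [f ^+ 2 - f * (32 / lam)]. The assumption on [S] makes the mean [y] of [f] at least
    [64 / lam], so the correction costs at most half of [y ^+ 2]. *)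
Lemma pair_prob_spread (S : {set node m}) :
  64 * 576 / lam <= #|S|%:R / n ->
  spread_const R * (#|S|%:R / n) ^+ 2 <= \sum_(a in S) \sum_(b in S) nu a b.
Proof.
rewrite /spread_const => Sbig; pose k u j := #|S :&: A u j|.
pose f u j : R := (k u j)%:R / #|A u j|%:R.
pose y : R := n ^- 2 * \sum_u \sum_j f u j.
have ni0 : 0 <= n ^- 2 by rewrite invr_ge0 exprn_ge0 // ltW.
have f0 u j : 0 <= f u j by rewrite divr_ge0 ?ler0n.
have yS : #|S|%:R / n / 576 <= y.
  have -> : #|S|%:R / n / 576 = n ^- 2 * (#|S|%:R * (lam * n / 16) / (36 *
    lam)).
    move: n0 lam0; rewrite !lt0r => /andP [nn _] /andP [ln _].
    by move: (n) (lam) nn ln => n' l' nn ln; field; rewrite nn ln.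
  have l36 : 0 < 36 * lam by rewrite pmulr_rgt0.
  rewrite ler_wpM2l // ler_pdivrMr //.
  apply: (@le_trans _ _ (\sum_(v in S) occ v)).
    by rewrite [leLHS]mulr_natl -sumr_const; apply: ler_sum => v _.
  rewrite /occ exchange_big /= big_distrl /=; apply: ler_sum => u _.
  rewrite exchange_big /= big_distrl /=; apply: ler_sum => j _.
  have -> : \sum_(v in S) (v \in A u j)%:R = (k u j)%:R :> R.
    rewrite -natr_sum /k -sum1_card big_mkcond [in RHS]big_mkcond /=.
    congr (_%:R); apply: eq_bigr => v _; rewrite in_setI.
    by case: (v \in S); case: (v \in A u j).
  rewrite /f mulrAC ler_pdivlMr // ler_wpM2l ?ler0n //.
(* Jensen in tangent form: [f^2 >= 2 y f - y^2] for the mean [y] of [f]. *)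
have term u j : f u j * (2 * y - 32 / lam) - y ^+ 2 <=
    \sum_(a in S) \sum_(b in S) mu pl u j (a, b).
  have -> : \sum_(a in S) \sum_(b in S) mu pl u j (a, b) =
      (k u j * (k u j - 1))%N%:R / (#|A u j| * (#|A u j| - 1))%N%:R.
    transitivity (\sum_(a in S :&: A u j) ((k u j - 1)%N%:R /
        (#|A u j| * (#|A u j| - 1))%N%:R) : R).
      rewrite big_mkcond [RHS]big_mkcond; apply: eq_bigr => a _ /=.
      rewrite in_setI; case: (boolP (a \in S)) => //= aS.
      case: (boolP (a \in A u j)) => aA; last first.
        by apply: big1 => b _; rewrite muE (negbTE aA).
      rewrite (eq_bigr (fun b => if b \in A u j :\ a then
        (#|A u j| * (#|A u j| - 1))%N%:R^-1 else 0)); last first.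
        by move=> b _; rewrite muE aA /= !inE eq_sym andbC.
      rewrite -big_mkcondr (eq_bigl (fun b => b \in (S :&: A u j) :\ a)) /=;
        last first.
        by move=> b; rewrite !(in_setD1, in_setI) andbCA.
      rewrite sumr_const [RHS]mulr_natl; congr (_ *+ _).
      by rewrite /k (cardsD1 a (S :&: _)) in_setI aS aA addKn.
    by rewrite sumr_const -/(k u j) -[LHS]mulr_natl [(k u j * _)%N%:R]natrM
      mulrA.
  apply: (@le_trans _ _ (f u j ^+ 2 - f u j * (32 / lam))).
    have := sqr_ge0 (f u j - y); nra.
  apply: (@le_trans _ _ ((k u j * (k u j - 1))%N%:R / #|A u j|%:R ^+ 2)).
    have -> : (k u j * (k u j - 1))%N%:R = (k u j)%:R ^+ 2 - (k u j)%:R :> R.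
      case: (k u j) => [|i]; first by rewrite expr0n subr0.
      by rewrite subn1 /= natrM -[i.+1%:R]natr1; ring.
    rewrite mulrBl -exprVn -exprMn -/(f u j) lerD2l lerN2.
    by rewrite exprVn expr2 invfM mulrA -/(f u j) ler_wpM2l.
  rewrite ler_wpM2l ?ler0n // lef_pV2 ?posrE ?exprn_gt0 //; last first.
    by rewrite ltr0n muln_gt0 subn_gt0 (cardA2 u j) (ltnW (cardA2 u j)).
  by rewrite -natrX ler_nat -mulnn leq_mul2l leq_subr orbT.
have -> : \sum_(a in S) \sum_(b in S) nu a b =
    n ^- 2 * \sum_u \sum_j \sum_(a in S) \sum_(b in S) mu pl u j (a, b).
  under eq_bigr do under eq_bigr do rewrite pair_probE.
  under eq_bigr do rewrite -big_distrr /=.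
  rewrite -big_distrr /=; congr (_ * _).
  under eq_bigr do rewrite exchange_big /=.
  rewrite exchange_big /=; apply: eq_bigr => u _.
  under eq_bigr do rewrite exchange_big /=.
  by rewrite exchange_big.
apply: (@le_trans _ _ (n ^- 2 * \sum_u \sum_j
    (f u j * (2 * y - 32 / lam) - y ^+ 2))); last first.
  by rewrite ler_wpM2l //; do 2!(apply: ler_sum => ? _).
under eq_bigr do rewrite sumrB -big_distrl /= sumr_const card_ord.
rewrite sumrB -big_distrl /= sumr_const card_node mulrBr [n ^- 2 * (_ *
  _)]mulrA -/y.
have -> : n ^- 2 * (y ^+ 2 *+ m ^ 2 *+ m ^ 2) = y ^+ 2.
  rewrite -mulrnA -mulr_natr natrM -/n -expr2 mulrC mulfK //.
  by rewrite expf_neq0 // gt_eqF.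
move: yS Sbig; set s := #|S|%:R / n => yS Sbig.
have y64 : 64 / lam <= y.
  apply: le_trans yS; have : 64 * 576 / lam = 576 * (64 / lam) by field;
    rewrite gt_eqF.
  by move: Sbig; lra.
have s0 : 0 <= s by rewrite divr_ge0 ?ler0n ?(ltW n0).
move: y64; have -> : 64 / lam = 2 * (32 / lam) by field; rewrite gt_eqF.
have -> : (2 * 576 ^+ 2)^-1 * s ^+ 2 = (s / 576) ^+ 2 / 2 by field.
have : 0 <= s / 576 by rewrite divr_ge0.
move: (32 / lam) (s / 576) (y) yS => L s' z zs s'0 zL.
have h1 : s' ^+ 2 <= z ^+ 2 by rewrite lerXn2r ?nnegrE //; lra.
have h2 : 0 <= z * (z - 2 * L) by apply: mulr_ge0; lra.
by move: h1 h2; nra.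
Qed.

(** One choice is close with probability at most [9 * 32 / 96 ^+ 2], that is 1/32, and there are
    two. [96 <= r] makes the small radius at least 1, as [card_tball] requires. *)
Lemma close_prob_le : 96 <= r ->
  \sum_(q | ((tdist (origin q) (choices q).1)%:R <= r / 96) ||
            ((tdist (origin q) (choices q).2)%:R <= r / 96)) w q <= 16^-1.
Proof.
move=> r96; pose F (u a : node m) : R := ((tdist u a)%:R <= r / 96)%R%:R.
apply: (@le_trans _ _ (\sum_q w q * F (origin q) (choices q).1 +
                       \sum_q w q * F (origin q) (choices q).2)).
  rewrite -big_split /= big_mkcond /=; apply: ler_sum => q _; rewrite /F.
  have q0 := request_weight_ge0 q.
  move: (_ <= r / 96) (_ <= r / 96) => b1 b2.
  by case: b1; case: b2; rewrite /= ?mulr1 ?mulr0 ?addr0 ?add0r ?lerDl.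
rewrite (second_choice_expect F) (first_choice_expect F).
suff : n ^- 2 * \sum_u \sum_j \sum_(a in A u j) F u a / #|A u j|%:R <= 32^-1.
  by lra.
have s1 : 1 <= r / 96 by lra.
have sm : r / 96 <= m%:R by move: rm; lra.
apply: (@le_trans _ _ (n ^- 2 * \sum_u \sum_j \sum_a
  ((a \in tball (r / 96) u) && (j \in pl a))%:R * (32 / lam))).
  rewrite ler_wpM2l ?invr_ge0 ?exprn_ge0 ?(ltW n0) //.
  apply: ler_sum => u _; apply: ler_sum => j _; rewrite big_mkcond.
  apply: ler_sum => a _.
  have e0 : 0 <= 32 / lam by rewrite divr_ge0 ?(ltW lam0).
  case: ifP => [aA|_]; last by rewrite mulr_ge0 ?ler0n.
  move: (aA); rewrite /F !inE => /andP [_ ->]; rewrite andbT.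
  by case: (_ <= r / 96); rewrite ?mul0r // !mul1r.
apply: (@le_trans _ _ (n ^- 2 * (\sum_(a : node m) 9 * (r / 96) ^+ 2 * M%:R) *
  (32 / lam))).
  rewrite -[leRHS]mulrA ler_wpM2l ?invr_ge0 ?exprn_ge0 ?(ltW n0) //.
  under eq_bigr do rewrite exchange_big /=.
  rewrite exchange_big big_distrl /=; apply: ler_sum => a _.
  under eq_bigr do rewrite -big_distrl /=.
  have e0 : 0 <= 32 / lam by apply: divr_ge0; rewrite ?ltW.
  rewrite -big_distrl /= ler_wpM2r // holders_count.
  have /andP [_ b2] := card_tball a s1 sm.
  by apply: ler_pM; rewrite ?ler0n // ler_nat card_files_le.
rewrite sumr_const card_node -[_ *+ (m ^ 2)]mulr_natr -/n.
have -> : 9 * (r / 96) ^+ 2 * M%:R = 9 / 96 ^+ 2 * (lam * n).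
  by rewrite lamE; field.
rewrite le_eqVlt; apply/orP; left; apply/eqP.
move: n0 lam0; rewrite !lt0r => /andP [nn _] /andP [ln _].
by move: (n) (lam) nn ln => n' l' nn ln; field; rewrite nn ln.
Qed.

Lemma request_support q : w q != 0 ->
  ((tdist (origin q) (choices q).1)%:R <= r) &&
  ((tdist (origin q) (choices q).2)%:R <= r).
Proof.
rewrite /request_weight; case: (choices q) => a b; rewrite muE.
case: ifP => [/and3P []|_]; last by rewrite !(mulr0, mul0r) eqxx.
by rewrite !inE => /andP [-> _] /andP [-> _].
Qed.

End Sampling.

(** * Failure probabilities *)

Section FixedPlacement.
Variables (R : realType) (m M : nat) (r : R).
Variable mu : placement m M -> node m -> file m -> node m * node m -> R.
Variable pl : placement m M.
Hypothesis m0 : (0 < m)%N.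
Hypothesis r96 : 96 <= r.
Hypothesis rm : r <= m%:R.
Hypothesis law : two_choices_law r mu.
Hypothesis good : good_placement r pl.
Hypothesis lam64 : 64 <= density m M r.
Hypothesis M2 : (2 <= M)%N.
Let n : R := (m ^ 2)%N%:R.
Local Notation lam := (density m M r).
Local Notation w := (request_weight mu pl).

Variables (l K k : nat) (f lo hi : R).
Local Notation c := (spread_const R).
Local Notation x := (level_density (c / (32 * l%:R))).
Hypothesis l0 : (0 < l)%N.
Hypothesis xl_n : 1 <= x l * n.
Hypothesis xl_lam : 2 * (64 * 576 / lam) <= x l.
Hypothesis f01 : 0 < f <= 1.
Hypothesis fK : 2^-1 ^+ (2 ^ K) <= f.
Hypothesis lo_le : lo <= l%:R.
Hypothesis hi_ge : (16 * 288 * K + k)%N%:R <= hi.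

Lemma fixed_placement_failure :
  \sum_(t : (m ^ 2).-tuple (request m) |
     ~~ [&& lo <= (max_load t)%:R, (max_load t)%:R <= hi,
            r / 96 / 2 <= comm_cost R t & comm_cost R t <= r])
    \prod_(q <- t) w q <=
  expR (- (c * x l ^+ 2 * n / 16)) +
  (K%:R * (n * expR (- (36 * (f * lam)))) + n * (expR (4 * 288) * f ^+ k)) +
  (2 ^+ (m ^ 2))^-1.
Proof.
have n0 : 0 < n by rewrite ltr0n expn_gt0 m0.
have lam0 : 0 < lam by apply: lt_le_trans lam64; rewrite ltr0n.
have r1 : 1 <= r by move: r96; lra.
have w0 := request_weight_ge0 pl law.
have w1 := request_weight_sum pl m0 law.
have nus := pair_prob_sym m0 law good lam64.
have numax0 : 0 < 9 * 2048 / (n * lam) 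
  by apply: divr_gt0; [rewrite mulr_gt0 | exact: mulr_gt0].
have c01 := spread_const01 R.
have low := max_load_lower w0 w1 m0 c01 l0 (erefl _) xl_n.
have {}low : \sum_(t : (m ^ 2).-tuple (request m) |
    [forall v, (hist_load t v < l)%N]) \prod_(q <- t) w q
    <= expR (- (c * x l ^+ 2 * n / 16)).
  apply: low => S Sbig; apply: (pair_prob_spread m0 r1 rm law good lam64 M2).
  apply: (@le_trans _ _ (x l / 2)); first by move: xl_lam; lra.
  by rewrite ler_pdivlMr // mulrAC.
have up := max_load_upper w0 w1 nus (C := 288) k m0 _
  (pair_prob_row_le m0 r1 rm law good lam64) numax0
  (pair_prob_le m0 r1 rm law good lam64) _ f01 fK (g := (16 * 288)%N).
have {}up : \sum_(t : (m ^ 2).-tuple (request m) |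
      [exists v, (16 * 288 * K + k <= hist_load t v)%N]) \prod_(q <- t) w q
  <= K%:R * (n * expR (- (36 * (f * lam)))) + n * (expR (4 * 288) * f ^+ k).
  apply: le_trans (up _ _) _ => //; first by rewrite natrM.
  rewrite -/n.
  (* The constant 36 is [8 * 288 ^+ 2 / (9 * 2048)]. *)
  rewrite lerD2r ler_wpM2l ?ler0n // ler_pM2l // ler_expR lerN2.
  rewrite le_eqVlt; apply/orP; left; apply/eqP.
  by move: (n) (lam) (lt0r_neq0 n0) (lt0r_neq0 lam0) => n' l' nn ln; field;
    rewrite nn ln.
pose P (q : request m) := ((tdist (origin q) (choices q).1)%:R <= r / 96) ||
            ((tdist (origin q) (choices q).2)%:R <= r / 96).
have cls := count_tail (m ^ 2) w0 w1
  (close_prob_le m0 rm law good lam64 r96).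
rewrite -/P in cls.
(* The fourth event, some request of weight 0, has probability 0; outside it all choices are within
   distance [r]. *)
pose F (i : 'I_4) (t : (m ^ 2).-tuple (request m)) := match val i with
  | 0 => [forall v, (hist_load t v < l)%N]
  | 1 => [exists v, (16 * 288 * K + k <= hist_load t v)%N]
  | 2 => (m ^ 2 <= 2 * count P t)%N
  | _ => has (fun q => w q == 0) t
  end.
apply: le_trans (sum_union_le (F := F) _ _) _.
- by move=> t; apply: prodr_ge0.
- move=> t nE; apply/existsP; apply: contraNT nE;
    rewrite negb_exists => /forallP none.
  have no i : F i t = false by apply/negbTE/none.
  have := no (@Ordinal 4 0 isT); rewrite /F /= => /negbT.
  rewrite negb_forall => /existsP [v0]; rewrite -leqNgt => lv0.
  have := no (@Ordinal 4 1 isT); rewrite /F /= => /negbT.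
  rewrite negb_exists => /forallP small.
  have := no (@Ordinal 4 2 isT); rewrite /F /= => /negbT; rewrite -ltnNge => cl.
  have := no (@Ordinal 4 3 isT); rewrite /F /= => /negbT;
    rewrite -all_predC => /allP sup.
  have st : (0 < size t)%N by rewrite size_tuple expn_gt0 m0.
  apply/and4P; split.
  + apply: le_trans lo_le _; rewrite ler_nat; apply: leq_trans lv0 _.
    exact: (leq_bigmax v0).
  + apply: le_trans hi_ge; rewrite ler_nat; apply/bigmax_leqP => v _.
    by apply: ltnW; rewrite ltnNge small.
  + apply: comm_cost_ge => //; first by rewrite divr_ge0 //; lra.
    by rewrite -/P size_tuple ltnW.
  + apply: comm_cost_le => // q qt.
    exact: (request_support law good lam64 (sup q qt)).
rewrite !big_ord_recl big_ord0 /= addr0.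
rewrite [X in _ + (_ + (_ + X))]big1 ?addr0.
  by rewrite -[leRHS]addrA; apply: lerD => //; apply: lerD.
move=> t /hasP [q qt /eqP q0].
by rewrite (big_rem q) //= q0 mul0r.
Qed.

End FixedPlacement.

(** Conditioning on the placement: mass at least [1 - F1] is good, and each good placement succeeds
    with probability at least [1 - F2]. *)
Lemma Prob_ge (R : realType) (m M : nat) (r F1 F2 : R)
    (mu : placement m M -> node m -> file m -> node m * node m -> R)
    (E : pred (outcome m M)) (G : pred (placement m M)) :
  (0 < m)%N -> two_choices_law r mu -> 0 <= F2 ->
  \sum_(pl | ~~ G pl) placement_weight R pl <= F1 ->
  (forall pl, G pl -> \sum_(t : (m ^ 2).-tuple (request m) | ~~ E (pl, t))
      \prod_(q <- t) request_weight mu pl q <= F2) ->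
  1 - (F1 + F2) <= Prob mu E.
Proof.
move=> m0 law F20 HF1 HF2.
have w0 := request_weight_ge0 _ law.
have pw0 := @placement_weight_ge0 R m M.
have -> : Prob mu E = \sum_pl placement_weight R pl *
    \sum_(t : (m ^ 2).-tuple (request m) | E (pl, t))
       \prod_(q <- t) request_weight mu pl q.
  under [RHS]eq_bigr do rewrite big_distrr big_mkcond /=.
  by rewrite /Prob big_mkcond pair_bigA; apply: eq_bigr => [[pl t] _].
have Gsum : \sum_(pl | G pl) placement_weight R pl =
    1 - \sum_(pl | ~~ G pl) placement_weight R pl.
  rewrite -(placement_weight_sum R M m0) [in RHS](bigID G) /=; ring.
have G1 : \sum_(pl | G pl) placement_weight R pl <= 1.
  by rewrite Gsum gerBl sumr_ge0.
apply: (@le_trans _ _ (\sum_(pl | G pl) placement_weight R pl * (1 - F2))).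
  rewrite -big_distrl /=; move: Gsum G1 HF1.
  set a := \sum_(pl | G pl) _; set b := \sum_(pl | ~~ G pl) _ => ab a1 bF.
  have -> : a * (1 - F2) = a - a * F2 by ring.
  have : a * F2 <= F2 by apply: ler_piMl.
  lra.
rewrite [leRHS](bigID G) /= -[leLHS]addr0; apply: lerD; last first.
  by apply: sumr_ge0 => pl _; rewrite mulr_ge0 // sumr_ge0 // => t _;
    apply: prodr_ge0.
apply: ler_sum => pl Gpl; rewrite ler_wpM2l //.
have := sum_prob_tuple (m ^ 2) (request_weight_sum pl m0 law).
rewrite (bigID (fun t => E (pl, t))) /=.
move: (HF2 pl Gpl); set a := \sum_(t | ~~ _) _; set b := \sum_(t | _) _; lra.
Qed.

(** * Asymptotics *)

Lemma expR1_le4 (R : realType) : expR (1 : R) <= 4.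
Proof.
have -> : expR 1 = expR 2^-1 * expR 2^-1 :> R by rewrite -expRD; congr expR;
  field.
have := expR_half_le2 R; have := expR_gt0 (2^-1 : R).
by move: (expR 2^-1) => E; nra.
Qed.

Lemma leq_4half (k : nat) : (2 <= k)%N -> (k <= 4 * k./2)%N.
Proof. lia. Qed.

(** The quadratic term of the exponential series suffices. *)
Lemma exp_beats_linear (R : realType) (a e X : R) :
  0 < a -> 0 < e -> 8 / (a * e ^+ 2) <= X -> 4 * X <= a * expR (e * X).
Proof.
move=> a0 e0; have ae : 0 < a * e ^+ 2 by rewrite mulr_gt0 ?exprn_gt0.
rewrite ler_pdivrMr // => hX.
have X0 : 0 < X.
  rewrite ltNge; apply/negP => Xle; have : X * (a * e ^+ 2) <= 0.
    by rewrite mulr_le0_ge0 // ltW.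
  by move: hX; lra.
have H := @expR_ge1Dxn R (e * X) 1 (mulr_ge0 (ltW e0) (ltW X0)).
apply: (@le_trans _ _ (a * ((e * X) ^+ 2 / 2))).
  have -> : a * ((e * X) ^+ 2 / 2) = (X * (a * e ^+ 2)) * (X / 2) by field.
  have : 8 * (X / 2) <= (X * (a * e ^+ 2)) * (X / 2) by rewrite ler_pM2r
    ?divr_gt0.
  by lra.
rewrite ler_pM2l //; apply: le_trans H; rewrite lerDr //.
Qed.

(** For [K] just above [2 * ln X], [2 ^+ K] is at least [expR (K / 2)], hence at least [X]. *)
Lemma half_tower_le (R : realType) (d X : R) : 0 < X -> d <= 1 ->
  2^-1 ^+ (2 ^ (Num.truncn (2 * ln X)).+1) <= expR (- (d * X / 2)).
Proof.
move=> X0 d1; set K := (Num.truncn _).+1.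
have hK : 2 * ln X < K%:R by apply: truncnS_gt.
have h : 2^-1 <= expR (- 2^-1) :> R.
  by have := expR_ge1Dx (- 2^-1 : R); lra.
apply: (@le_trans _ _ (expR (- 2^-1) ^+ (2 ^ K))).
  by apply: lerXn2r; rewrite ?nnegrE ?expR_ge0 ?invr_ge0.
rewrite -expRM_natl ler_expR natrX.
have dX : d * X <= X by rewrite ger_pMl.
suff : X <= 2 ^+ K by move: (2 ^+ K) => P; lra.
apply: (@le_trans _ _ (expR (2^-1) ^+ K)); last first.
  by apply: lerXn2r; rewrite ?nnegrE ?expR_ge0 // expR_half_le2.
rewrite -expRM_natl -[leLHS]lnK ?posrE // ler_expR; lra.
Qed.

(** With [l] near [ln X / 2], [2 ^ l] is at most twice the square root of [X], and [- ln y] is at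
    most of order [ln X]; the assumption on [ln X] brings their product below [d * X / 4]. *)
Lemma level_density_ge (R : realType) (c d X : R) (l : nat) :
  0 < c <= 1 -> 0 < d -> 0 < X -> 8 * (256 / (c * d)) + 2 <= ln X ->
  l = (Num.truncn (ln X / 2)).+1 ->
  expR (- (d * X / 4)) <= level_density (c / (32 * l%:R)) l.
Proof.
move=> /andP [c0 c1] d0 X0; set kap := 256 / (c * d) => hL ldef.
have kap0 : 0 < kap by rewrite divr_gt0 ?mulr_gt0.
set u := ln X / 2; have u0 : 1 <= u by rewrite /u; lra.
have uk : 4 * kap <= u by rewrite /u; lra.
have XE : X = expR u * expR u by rewrite -expRD /u -splitr lnK.
have /andP [tl tu] := truncn_itv (le_trans ler01 u0).
have lE : l%:R = (Num.truncn u)%:R + 1 :> R by rewrite natr1 ldef.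
have l0 : 0 < l%:R :> R by rewrite ldef ltr0n.
set z := 32 * l%:R / c; have z0 : 0 < z by rewrite divr_gt0 ?mulr_gt0.
have yz : c / (32 * l%:R) = z^-1 by rewrite invf_div.
have eu : kap * (u + 1) <= expR u.
  have := @expR_ge1Dxn R u 1 (le_trans ler01 u0).
  have : 2 * kap * u <= u ^+ 2 / 2 by nra.
  have -> : (1.+1)`!%:R = 2 :> R by [].
  by move: (expR u) => E ? ?; nra.
have two : (2 ^ l)%N%:R <= 2 * expR u :> R.
  rewrite ldef expnS natrM ler_pM2l // natrX -/u.
  apply: (@le_trans _ _ (expR 1 ^+ Num.truncn u)).
    apply: lerXn2r; rewrite ?nnegrE ?expR_ge0 //.
    exact: (expR_ge1Dx 1).
  by rewrite -expRM_natl mulr1 ler_expR.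
have main : (2 ^ l)%N%:R * z <= d * X / 4.
  apply: (@le_trans _ _ (2 * expR u * (32 * (u + 1) / c))).
    apply: ler_pM => //; rewrite ?ler0n ?(ltW z0) //.
    by rewrite /z ler_pM2r ?invr_gt0 // ler_pM2l //; lra.
  have -> : 2 * expR u * (32 * (u + 1) / c) = d / 4 * expR u * (kap * (u + 1)).
    by rewrite /kap; field; rewrite !gt_eqF.
  have -> : d * X / 4 = d / 4 * expR u * expR u by rewrite XE; ring.
  by rewrite ler_pM2l // mulr_gt0 ?expR_gt0 // divr_gt0.
(* The crude [ln z <= z] is affordable, [z] being of order [ln X]. *)
have ez : expR (- z) <= z^-1.
  rewrite expRN lef_pV2 ?posrE ?expR_gt0 //.
  by apply: le_trans (expR_ge1Dx _); rewrite lerDr.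
have z1 : z^-1 <= 1.
  rewrite invf_le1 // /z ler_pdivlMr // mul1r.
  have : 1 <= l%:R :> R by rewrite ldef ler1n.
  by lra.
rewrite /level_density yz; apply: (@le_trans _ _ (z^-1 ^+ (2 ^ l))); last first.
  by apply: ler_wiXn2l; rewrite ?invr_ge0 ?(ltW z0) // leq_subr.
apply: (@le_trans _ _ (expR (- z) ^+ (2 ^ l))); last first.
  by apply: lerXn2r; rewrite ?nnegrE ?expR_ge0 // invr_ge0 ltW.
by rewrite -expRM_natl ler_expR mulrN lerN2.
Qed.

Lemma mem_le_foldr_max (R : realType) (ts : seq R) (t : R) :
  t \in ts -> t <= foldr Num.max 0 ts.
Proof.
elim: ts => //= s ts IH; rewrite inE le_max => /orP [/eqP ->|/IH ->].
  by rewrite lexx.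
by rewrite orbT.
Qed.

Lemma level_density_gap (R : realType) (t lam x : R) :
  256 * 576 * 2 <= t -> expR t / 2 <= lam -> expR (- (t / 4)) <= x ->
  2 * (64 * 576 / lam) <= x.
Proof.
move=> ht hlam /(le_trans _); apply.
have lam0 : 0 < lam by apply: lt_le_trans hlam; rewrite divr_gt0 ?expR_gt0.
rewrite mulrA ler_pdivrMr //.
apply: (@le_trans _ _ (expR (- (t / 4)) * (expR t / 2))); last first.
  by rewrite ler_pM2l ?expR_gt0.
rewrite [leRHS]mulrA -expRD ler_pdivlMr //.
by apply: le_trans (expR_ge1Dx _); lra.
Qed.

Lemma placement_failure_le (R : realType) (n X lam : R) (k : nat) :
  n = expR X -> 0 <= X -> 4 * X <= lam / 32 -> 4 * X <= k%:R ->
  n ^+ 2 * (expR (- (9 * lam)) + expR (- (lam / 32))) + n * 4^-1 ^+ k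
    <= 3 * expR (- (2 * X)).
Proof.
move=> -> X0 hlam hk; have E4 := expR_gt0 (- (4 * X)).
have A1 : expR (- (9 * lam)) <= expR (- (4 * X)) by rewrite ler_expR; lra.
have A2 : expR (- (lam / 32)) <= expR (- (4 * X)) by rewrite ler_expR; lra.
have A3 : 4^-1 ^+ k <= expR (- (4 * X)).
  apply: (@le_trans _ _ (expR (- 1) ^+ k)).
    apply: lerXn2r; rewrite ?nnegrE ?expR_ge0 ?invr_ge0 //.
    by rewrite expRN lef_pV2 ?posrE ?expR_gt0 // expR1_le4.
  by rewrite -expRM_natl mulrN1 ler_expR lerN2.
have -> : 3 * expR (- (2 * X)) =
    expR X ^+ 2 * (expR (- (4 * X)) + expR (- (4 * X))) + expR (- (2 * X)).
  rewrite mulrDr -expRM_natl -expRD.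
  have -> : 2%:R * X + - (4 * X) = - (2 * X) by ring.
  ring.
apply: lerD; first by rewrite ler_wpM2l ?sqr_ge0 // lerD.
apply: (@le_trans _ _ (expR X * expR (- (4 * X)))).
  by rewrite ler_pM2l ?expR_gt0.
by rewrite -expRD ler_expR; lra.
Qed.

Lemma request_failure_le (R : realType) (n K : nat) (X s t E fk : R) :
  n%:R = expR X -> 0 <= X -> 8 * X <= n%:R -> K%:R <= n%:R :> R ->
  4 * X <= s -> 4 * X <= t -> fk <= expR (- (3 * X)) -> 0 <= E ->
  expR (- s) + (K%:R * (n%:R * expR (- t)) + n%:R * (E * fk)) + (2 ^+ n)^-1
    <= (3 + E) * expR (- (2 * X)).
Proof.
move=> nX X0 n8 Kn hs ht hfk E0.
have A1 : expR (- s) <= expR (- (2 * X)) by rewrite ler_expR; lra.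
have A2 : K%:R * (n%:R * expR (- t)) <= expR (- (2 * X)).
  apply: (@le_trans _ _ (n%:R * (n%:R * expR (- (4 * X))))).
    apply: ler_pM; rewrite ?ler0n ?mulr_ge0 ?expR_ge0 ?ler0n //.
    by rewrite ler_wpM2l ?ler0n // ler_expR lerN2.
  by rewrite nX -!expRD ler_expR; lra.
have A3 : n%:R * (E * fk) <= E * expR (- (2 * X)).
  rewrite mulrCA ler_wpM2l //.
  apply: (@le_trans _ _ (n%:R * expR (- (3 * X))));
    first by rewrite ler_wpM2l ?ler0n.
  by rewrite nX -expRD ler_expR; lra.
have A4 : (2 ^+ n)^-1 <= expR (- (2 * X)).
  apply: (@le_trans _ _ (expR (- 2^-1) ^+ n)).
    rewrite -exprVn; apply: lerXn2r; rewrite ?nnegrE ?expR_ge0 ?invr_ge0 //.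
    by have := expR_ge1Dx (- 2^-1 : R); lra.
  by rewrite -expRM_natl mulrN ler_expR; lra.
by rewrite mulrDl; lra.
Qed.

Lemma lower_exponent_ge (R : realType) (c d X x n : R) :
  0 < c -> 0 < X -> d <= 2^-1 -> 8 / (c / 16 * 2^-1 ^+ 2) <= X ->
  expR (- (d * X / 4)) <= x -> n = expR X -> 4 * X <= c * x ^+ 2 * n / 16.
Proof.
move=> c0 X0 d2 thr hx nX; have c16 : 0 < c / 16 by rewrite divr_gt0.
have i2 : 0 < 2^-1 :> R by rewrite invr_gt0.
apply: le_trans (exp_beats_linear c16 i2 thr) _.
have -> : c * x ^+ 2 * n / 16 = c / 16 * (x ^+ 2 * n) by ring.
rewrite ler_pM2l //.
apply: (@le_trans _ _ (expR (- (d * X / 4)) ^+ 2 * n)); last first.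
  rewrite nX ler_pM2r ?expR_gt0 // lerXn2r ?nnegrE ?expR_ge0 //.
  exact: le_trans (expR_ge0 _) hx.
have dX2 : d * X <= X / 2 by rewrite mulrC ler_pM2l.
by rewrite nX -expRM_natl -expRD ler_expR; lra.
Qed.

(** The product on the right is at least [18 * expR (d / 2 * X)], a positive power of [n] when [X]
    is [ln n]. *)
Lemma upper_exponent_ge (R : realType) (d X lam : R) :
  0 < d -> 8 / (18 * (d / 2) ^+ 2) <= X -> expR (d * X) / 2 <= lam ->
  4 * X <= 36 * (expR (- (d * X / 2)) * lam).
Proof.
move=> d0 thr hlam; have d2 : 0 < d / 2 by rewrite divr_gt0.
have i18 : 0 < 18 :> R by rewrite ltr0n.
have := exp_beats_linear i18 d2 thr.
have : expR (d / 2 * X) / 2 <= expR (- (d * X / 2)) * lam; last by lra.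
apply: (@le_trans _ _ (expR (- (d * X / 2)) * (expR (d * X) / 2))); last first.
  by rewrite ler_pM2l // expR_gt0.
rewrite mulrA -expRD le_eqVlt; apply/orP; left; apply/eqP.
by congr (expR _ / 2); field.
Qed.

Lemma load_cap_le (R : realType) (g K k : nat) (L : R) :
  2 <= L -> K%:R <= 2 * L + 1 -> (g * K + k)%N%:R <= (g%:R * 3 + k%:R) * L.
Proof.
move=> L2 KL; rewrite natrD natrM mulrDl -mulrA lerD //.
  by rewrite ler_wpM2l ?ler0n //; lra.
by rewrite ler_peMr ?ler0n //; lra.
Qed.

Lemma le_ln_of_gt (R : realType) (X : R) (n : nat) :
  ((Num.truncn (expR X)).+1 <= n)%N -> X <= ln n%:R.
Proof.
move=> hn; rewrite -[X]expRK ler_ln ?posrE ?expR_gt0 //; last first.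
  by rewrite ltr0n; apply: leq_trans hn.
by apply: le_trans (ltW (truncnS_gt _)) _; rewrite ler_nat.
Qed.

(** * Choice of the constants and assembly of the bounds *)

Theorem theorem4 (R : realType) (alpha beta : R)
    (halpha : 0 < alpha < 2^-1) (hbeta : 0 < beta < 2^-1) :
  exists (c l1 l2 k1 k2 : R) (n0 : nat),
    [/\ 0 < c, 0 < l1, 0 < l2, 0 < k1 & 0 < k2] /\
    forall m : nat,
      let n := (m ^ 2)%N in
      let M := cache_size m alpha in
      let r := radius m beta in
      (n0 <= n)%N ->
      alpha + 2 * beta >= 1 + 2 * (ln (ln n%:R) / ln n%:R) ->
      forall mu : placement m M -> node m -> file m -> node m * node m -> R,
        two_choices_law r mu ->
        1 - 1 / n%:R `^ c <=
        Prob mu (fun w =>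
          [&& l1 * ln (ln n%:R) <= (max_load w.2)%:R,
              (max_load w.2)%:R <= l2 * ln (ln n%:R),
              k1 * r <= comm_cost R w.2 &
              comm_cost R w.2 <= k2 * r]).
Proof.
case/andP: halpha => a0 a2; case/andP: hbeta => b0 b2.
have [d dE] : exists d, d = alpha + 2 * beta - 1 by eexists.
(* This case contradicts the hypothesis: once [ln n >= 2], [ln (ln n) / ln n] is positive. *)
have [d0|d0] := leP d 0.
  exists 1, 1, 1, 1, 1, (Num.truncn (expR (2 : R))).+1; split; first by split.
  move=> m n M r /le_ln_of_gt X2 cond; exfalso.
  have : 0 < ln (ln n%:R) / ln n%:R :> R.
    by apply: divr_gt0; [apply: ln_gt0 |]; lra.
  by move: cond; lra.
have [c [cE c01]] : exists c, c = spread_const R /\ 0 < c <= 1.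
  by exists (spread_const R); split; last exact: spread_const01.
have c0 : 0 < c by case/andP: c01.
(* Ensures [6 <= k * d], so that [f ^+ k] is at most [n] to the power -3 for the [f] below. *)
pose k := (Num.truncn (6 / d)).+1.
(* Lower bounds on [X = ln n], each called later by its index through [thr]. *)
pose thresholds : seq R := [:: 95 / beta; 3 / alpha; 127 / d;
  256 * 576 * (2 / d); 8 / (64^-1 * d ^+ 2); 8 / (8^-1 * alpha ^+ 2);
  8 / (18 * (d / 2) ^+ 2); 8 / (c / 16 * 2^-1 ^+ 2); 8 / (2^-1 * 1 ^+ 2);
  6 + expR (4 * 288); expR (8 * (256 / (c * d)) + 2)].
pose X0 := foldr Num.max 0 thresholds.
(* [2^-1] comes from [l > ln X / 2], the upper load constant from [load_cap_le] with [g = 16 * 288],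
   and 1/192 is half of 1/96. *)
exists 1, 2^-1, ((16 * 288)%N%:R * 3 + k%:R), (192^-1), 1, (Num.truncn (expR
  X0)).+1.
split; first by split; rewrite ?invr_gt0 // addr_gt0 ?mulr_gt0 ?ltr0n.
move=> m n M r hn _ mu law.
have m0 : (0 < m)%N by move: hn; rewrite /n; case: (m).
have [X XE] : exists X : R, X = ln n%:R by eexists.
have n0 : 0 < n%:R :> R by rewrite ltr0n expn_gt0 m0.
have nX : n%:R = expR X by rewrite XE lnK.
have thr t : t \in thresholds -> t <= X.
  move=> tin; rewrite XE; apply: le_trans (le_ln_of_gt hn).
  exact: mem_le_foldr_max.
have {}thr i : (i < 11)%N -> thresholds`_i <= X.
  by move=> i11; apply: thr; apply: mem_nth.
have X1 : 6 <= X.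
  by apply: le_trans (thr 9 isT); rewrite /= lerDl expR_ge0.
have Xpos : 0 < X by apply: lt_le_trans X1; rewrite ltr0n.
have [l lE] : exists l, l = (Num.truncn (ln X / 2)).+1 by eexists.
have [xl xlE] : exists xl, xl = level_density (c / (32 * l%:R)) l by eexists.
have kap0 : 0 < 256 / (c * d) by rewrite divr_gt0 ?mulr_gt0.
have [xl_ge L2] : expR (- (d * X / 4)) <= xl /\ 2 <= ln X.
  have hL : 8 * (256 / (c * d)) + 2 <= ln X.
    by rewrite -ler_expR lnK ?posrE //; apply: (thr 10).
  split; first by rewrite xlE; apply: level_density_ge.
  by apply: le_trans hL; rewrite lerDr mulr_ge0 // ltW.
have LX : ln X <= X - 1.
  by rewrite -{1}[X](subrK 1) addrC le_ln1Dx //; lra.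
have pw (s : R) : n%:R `^ s = expR (s * X) by rewrite nX -expRM mulrC.
have rE : r = expR (beta * X) by rewrite /r /radius -/n pw.
have r96 : 96 <= r.
  rewrite rE; apply: le_trans (expR_ge1Dx _).
  by have := thr 0 isT; rewrite /= ler_pdivrMr // mulrC; lra.
have r1 : 1 <= r by lra.
have mX : m%:R ^+ 2 = expR X by rewrite -natrX.
have rm : r <= m%:R.
  rewrite -(@ler_pXn2r _ 2) ?nnegrE ?ler0n //; last by lra.
  by rewrite mX rE -expRM_natl ler_expR mulrA ger_pMl //; lra.
have [ea eaE] : exists ea, ea = expR (alpha * X) by eexists.
have ea4 : 4 <= ea.
  rewrite eaE; apply: le_trans (expR_ge1Dx _).
  by have := thr 1 isT; rewrite /= ler_pdivrMr // mulrC; lra.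
have ME : M = Num.truncn ea by rewrite /M /cache_size -/n pw eaE.
have /andP [Ml Mu] : M%:R <= ea < M.+1%:R by rewrite ME truncn_itv // eaE
  expR_ge0.
have Mhalf : ea / 2 <= M%:R by move: Mu; rewrite -natr1; lra.
have M2 : (2 <= M)%N by rewrite -(ler_nat R); lra.
have Mn : (M ^ 2 <= m ^ 2)%N.
  rewrite -(ler_nat R) -/n nX natrX; apply: (@le_trans _ _ (ea ^+ 2)).
    by rewrite lerXn2r ?nnegrE ?ler0n // eaE expR_ge0.
  by rewrite eaE -expRM_natl ler_expR mulrA ger_pMl //; lra.
have [lam lamE] : exists lam, lam = density m M r by eexists.
(* The factor 1/2 pays for truncating [n] to the power [alpha] in the cache size. *)
have lam_ge : expR (d * X) / 2 <= lam.
  rewrite lamE /density -/n nX rE -expRM_natl -expRN -mulrA -expRD.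
  apply: (@le_trans _ _ (ea / 2 * expR (2 * (beta * X) - X))); last first.
    by rewrite ler_pM2r ?expR_gt0.
  rewrite mulrAC eaE -expRD le_eqVlt; apply/orP; left; apply/eqP.
  by congr (expR _ / 2); rewrite dE; ring.
have lam64 : 64 <= lam.
  have : 128 <= expR (d * X); last by lra.
  apply: le_trans (expR_ge1Dx _).
  by have := thr 2 isT; rewrite /= ler_pdivrMr // mulrC; lra.
have lam0 : 0 < lam by lra.
have d12 : d <= 2^-1 by lra.
have dX0 : 0 < d * X by rewrite mulr_gt0.
have dX2 : d * X <= X / 2 by rewrite mulrC ler_pM2l.
have xl_n : 1 <= xl * n%:R.
  apply: (@le_trans _ _ (expR (- (d * X / 4)) * n%:R));
    last by rewrite ler_pM2r.
  by rewrite nX -expRD -[leLHS]expR0 ler_expR; lra.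
(* [f] is [n] to the power [- d / 2]: small enough that [n * f ^+ k] vanishes, large enough that
   [f * lam] still grows like a power of [n]. *)
have [f fE] : exists f, f = expR (- (d * X / 2)) by eexists.
have f01 : 0 < f <= 1 by rewrite fE expR_gt0 expR_le1 oppr_le0; lra.
have [K KE] : exists K, K = (Num.truncn (2 * ln X)).+1 by eexists.
have lo_le : 2^-1 * ln X <= l%:R by rewrite mulrC lE; apply: ltW (truncnS_gt _).
have L20 : 0 <= 2 * ln X by lra.
have Kle : K%:R <= 2 * ln X + 1.
  by rewrite KE -natr1 lerD2r; case/andP: (truncn_itv L20).
have M4 : 4 * X <= (M./2)%:R.
  have : M%:R <= (4 * M./2)%N%:R :> R by rewrite ler_nat leq_4half.
  rewrite natrM; have i0 : 0 < 8^-1 :> R by rewrite invr_gt0.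
  have := exp_beats_linear i0 a0 (thr 5 isT); rewrite -eaE; clear -Mhalf; lra.
have lam32 : 4 * X <= lam / 32.
  have i0 : 0 < 64^-1 :> R by rewrite invr_gt0.
  have := exp_beats_linear i0 d0 (thr 4 isT); clear -lam_ge; lra.
have n8 : 8 * X <= n%:R.
  have i0 : 0 < 2^-1 :> R by rewrite invr_gt0.
  have := exp_beats_linear i0 ltr01 (thr 8 isT); rewrite mul1r -nX; lra.
have Kn : K%:R <= n%:R :> R by clear -Kle LX n8 Xpos; lra.
have fk : f ^+ k <= expR (- (3 * X)).
  rewrite fE -expRM_natl ler_expR mulrN lerN2.
  have kd : 6 <= k%:R * d by rewrite -ler_pdivrMr //; apply: ltW (truncnS_gt _).
  have := ler_wpM2r (ltW Xpos) kd; move: (k%:R) => k'; clear; lra.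
have F1 : \sum_(pl : placement m M | ~~ good_placement r pl)
    placement_weight R pl <= 3 * expR (- (2 * X)).
  apply: le_trans (good_placement_whp m0 r1 rm Mn) _.
  by apply: placement_failure_le; rewrite // -?lamE // ltW.
have F2 : forall pl : placement m M, good_placement r pl ->
    \sum_(t : (m ^ 2).-tuple (request m) |
      ~~ [&& 2^-1 * ln X <= (max_load t)%:R,
             (max_load t)%:R <= ((16 * 288)%N%:R * 3 + k%:R) * ln X,
             192^-1 * r <= comm_cost R t & comm_cost R t <= 1 * r])
      \prod_(q <- t) request_weight mu pl q <=
    (3 + expR (4 * 288)) * expR (- (2 * X)).
  move=> pl good.
  have -> : 192^-1 * r = r / 96 / 2 by field.
  rewrite mul1r.
  have fK : 2^-1 ^+ (2 ^ K) <= f.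
    rewrite fE KE; apply: half_tower_le => //; apply: le_trans d12 _.
    by rewrite invf_le1 // ler1n.
  have l0 : (0 < l)%N by rewrite lE.
  have h4 : 256 * 576 * 2 <= d * X.
    by have := thr 3 isT; rewrite /= mulrA ler_pdivrMr // [X * d]mulrC.
  have gap := level_density_gap h4 lam_ge xl_ge.
  have hs := lower_exponent_ge c0 Xpos d12 (thr 7 isT) xl_ge nX.
  have ht := upper_exponent_ge d0 (thr 6 isT) lam_ge; rewrite -fE in ht.
  rewrite xlE cE in xl_n gap hs; rewrite lamE in gap lam64 ht.
  apply: le_trans (fixed_placement_failure m0 r96 rm law good lam64 M2
    l0 xl_n gap f01 fK lo_le (load_cap_le _ _ L2 Kle)) _.
  by apply: request_failure_le => //; rewrite ?expR_ge0 // ltW.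
have e0 := expR_gt0 (- (2 * X)).
have F20 : 0 <= (3 + expR (4 * 288)) * expR (- (2 * X)).
  by rewrite mulr_ge0 ?(ltW e0) // addr_ge0 ?expR_ge0.
rewrite -XE; apply: le_trans (Prob_ge m0 law F20 F1 F2).
(* The total failure is [6 + expR (4 * 288)] times [n ^- 2]; that constant is at most [X], hence at
   most [n]. *)
rewrite lerD2l lerN2 powRr1 ?(ltW n0) // div1r -mulrDl addrA.
have -> : n%:R^-1 = n%:R * expR (- (2 * X)).
  by rewrite nX -expRN -expRD; congr expR; ring.
rewrite ler_pM2r //; have -> : 3 + 3 = 6 :> R by ring.
apply: le_trans (thr 9 isT) _; rewrite nX.
by apply: le_trans (expR_ge1Dx _); rewrite lerDr.
Qed.
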